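(* Let $G$ be a finite soluble group. Then there exists a finite supersoluble group $H$ such that: (1) $\pi(H)=\pi(G)$; (2) $P_G(k)\ge P_H(k)$ for all $k\in\mathbb N$; (3) $d_p(G)\ge d_p(H)$ for all $p\in\pi(G)$; (4) $\pi(G/G')\subseteq\pi(H/H')$.
   Context: $\pi(X)$ denotes the set of primes dividing $|X|$; $P_G(k)$ is the probability that $k$ independent uniformly random elements of $G$ generate $G$; $d_p(G)$ is the minimal number of generators of a Sylow $p$-subgroup of $G$; $G'$ is the derived subgroup. *)

(* Defs.v *)
From HB Require Import structures.
From mathcomp Require Import all_boot all_order all_algebra all_fingroup all_solvable.
Set Implicit Arguments. Unset Strict Implicit. Unset Printing Implicit Defensive.

Section Defs.
Variable gT : finGroupType.
Implicit Types G A B : {group gT}.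
Local Open Scope group_scope.

Definition supersolvable G : Prop :=
  exists s : seq {group gT},
    [/\ path (fun A B : {group gT} => (A \subset B) && cyclic (B / A)) 1%G s,
        last 1%G s = G
      & all (fun A : {group gT} => A <| G) s].

Definition gen_by G (n : nat) : bool :=
  [exists t : n.-tuple gT, <<[set x in t]>> == G].

Lemma gen_by_card G : gen_by G #|G|.
Proof.
apply/existsP; exists (enum_tuple G) => /=.
by rewrite set_enum genGid.
Qed.

Lemma gen_by_ex G : exists n, gen_by G n.
Proof. by exists #|G|; apply: gen_by_card. Qed.

Definition min_gens G : nat := ex_minn (gen_by_ex G).


Definition n_gen_tuples G (k : nat) : nat :=
  #|[set t : k.-tuple gT | all (fun x => x \in G) t && (<<[set x in t]>> == G)]|.

Definition gen_prob G (k : nat) : rat :=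
  ((n_gen_tuples G k)%:R / (#|G| ^ k)%:R)%R.

End Defs.

(* Main.v *)
Require Import Defs.
From HB Require Import structures.
From mathcomp Require Import all_boot all_order all_algebra all_fingroup all_solvable.
From mathcomp Require Import zify.
Set Implicit Arguments. Unset Strict Implicit. Unset Printing Implicit Defensive.
Import GRing.Theory Num.Theory.

(** Write [d_p] for the rank of a Sylow [p]-subgroup of [G], and let [e_p] be [1]
    if [p] does not divide [|G/G'|] while some prime divisor [r] of [|G/G'|] divides
    [p - 1], and [0] otherwise.  The group [H] is the semidirect product of the
    [C_p^(d_p)] with [e_p = 1] by the product of the [C_p^(d_p)] with [e_p = 0], the
    latter acting on [C_p^(d_p)] by scalars through a non-trivial character that
    factors through a quotient [C_r].  Counting derivations yields
    [P_H(k) <= prod_p prod_(i < d_p) (1 - p^(i + e_p - k))].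

    That [P_G(k)] is at least this product is shown by induction along a chief series.
    If [N] is a minimal normal [p]-subgroup of [G] with [c] complements, then
    [P_G(k) = P_(G/N)(k) (1 - c / |N|^k)].  By Gaschuetz's theorem the number [c] is
    controlled by the restriction of complements to a Sylow subgroup [P], which gives
    [c <= |N|^(d(P/N)) |C_N(P)|].  This suffices unless [|N| = p], when the central
    case and the case where [p] divides [|G/G'|] need sharper counts.  Finally a
    complemented [N] forces [d(P) > d(P/N)], so [N] uses up a factor of the product. *)

(** * Counting a finite set through the fibres of a map *)

Section FibreCount.
Variables (aT rT : finType) (f : aT -> rT) (S : {set aT}) (T : {set rT}).

Lemma card_fibres :
  #|[set x in S | f x \in T]| = \sum_(y in T) #|[set x in S | f x == y]|.
Proof.
rewrite -sum1_card (partition_big f (mem T)) /=; last first.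
  by move=> x; rewrite inE => /andP[].
apply: eq_bigr => y Ty; rewrite -sum1_card; apply: eq_bigl => x.
by rewrite !inE; case: eqP => [->|]; rewrite ?andbF ?andbT // [y \in T]Ty andbT.
Qed.

Lemma leq_mul_card_fibres m :
  (forall y, y \in T -> m <= #|[set x in S | f x == y]|) -> #|T| * m <= #|S|.
Proof.
move=> le_m; rewrite -sum_nat_const.
apply: (@leq_trans (\sum_(y in T) #|[set x in S | f x == y]|)).
  exact: leq_sum.
rewrite -card_fibres.
by apply: subset_leq_card; apply/subsetP=> x; rewrite inE => /andP[].
Qed.

Lemma leq_card_mul_fibres m :
    (forall x, x \in S -> f x \in T) ->
    (forall y, y \in T -> #|[set x in S | f x == y]| <= m) ->
  #|S| <= #|T| * m.
Proof.
move=> fS le_m; rewrite -sum_nat_const.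
apply: (@leq_trans (\sum_(y in T) #|[set x in S | f x == y]|)); last first.
  exact: leq_sum.
rewrite -card_fibres.
by apply: subset_leq_card; apply/subsetP=> x xS; rewrite inE xS fS.
Qed.

End FibreCount.

(** * Lifting generating tuples modulo an abelian minimal normal subgroup *)

Section GeneratingTuples.
Local Open Scope group_scope.
Variables (gT : finGroupType) (G N : {group gT}).

Lemma quotient_gen_tuple k (t : k.-tuple gT) :
  all (fun x => x \in 'N(N)) t ->
  <<[set x in map_tuple (coset N) t]>> = <<[set x in t]>> / N.
Proof.
move=> /allP nt.
have sN : [set x in t] \subset 'N(N).
  by apply/subsetP=> x; rewrite inE => /nt.
rewrite quotient_gen // quotientE morphimEsub //; congr <<_>>.
apply/setP=> y; rewrite inE; apply/mapP/imsetP => [[x xt ->]|[x xt ->]].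
  by exists x; rewrite ?inE.
by exists x => //; rewrite inE in xt.
Qed.

Hypotheses (minN : minnormal N G) (sNG : N \subset G) (abN : abelian N).

Let nNG : G \subset 'N(N). Proof. by case/mingroupP: minN => /andP[]. Qed.

(** [N :&: M] is normalised by [M], and by [N] since [N] is abelian, hence by [G]; minimality leaves
    [1] and [N], and the latter would give [M = G]. *)
Lemma minnormal_supplement_complement (M : {group gT}) :
  N * M = G -> M :!=: G -> M \in [complements to N in G].
Proof.
move=> NM neM; apply/complP; split=> //.
have sMG : M \subset G by rewrite -NM mulG_subr.
apply/eqP; apply: contraNT neM => ntI.
case/mingroupP: minN => _ /(_ (N :&: M)%G) /=.
have nI : G \subset 'N(N :&: M).
  rewrite -NM mulG_subG; apply/andP; split.
    by rewrite cents_norm // centsC (subset_trans (subsetIl _ _)).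
  by rewrite normsI ?normG // (subset_trans sMG).
rewrite ntI subsetIl nI => /(_ isT isT) eqI.
suff sNM : N \subset M by rewrite -NM mulSGid.
by rewrite -eqI subsetIr.
Qed.

Lemma compl_coset_inj (M : {group gT}) x y :
  N :&: M = 1 -> x \in M -> y \in M -> x \in 'N(N) -> y \in 'N(N) ->
  coset N x = coset N y -> x = y.
Proof.
move=> tiNM Mx My nx ny /esym/rcoset_kercosetP => /(_ ny nx).
rewrite mem_rcoset => xy; have : y * x^-1 \in N :&: M.
  by rewrite inE xy groupM ?groupV.
by rewrite tiNM => /set1P/eqP; rewrite -eq_mulgV1 => /eqP.
Qed.

Lemma card_tuple_coset_fibre k (s : k.-tuple (coset_of N)) :
  all (fun x => x \in G / N) s ->
  #|N| ^ k <= #|[set t : k.-tuple gT | all (fun x => x \in G) t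
                                       & map_tuple (coset N) t == s]|.
Proof.
move=> /allP sG.
pose t0 i := repr (tnth s i).
have t0s i : coset N (t0 i) = tnth s i by exact: coset_reprK.
have nt0 i : t0 i \in 'N(N) by exact: repr_coset_norm.
have t0G i : t0 i \in G.
  have := sG _ (mem_tnth i s); rewrite -t0s => /morphimP[y ny yG].
  move/rcoset_kercosetP => /(_ (nt0 i) ny).
  by case/rcosetP => n nN ->; rewrite groupM // (subsetP sNG).
pose F (u : k.-tuple [subg N]) := [tuple t0 i * sgval (tnth u i) | i < k].
have injF : injective F.
  move=> u v /(congr1 (fun t => tnth t)) eqF; apply/eq_from_tnth => i.
  have := congr1 (@^~ i) eqF; rewrite /= !tnth_mktuple => /mulgI.
  exact: subg_inj.
have <- : #|[set F u | u in setT]| = (#|N| ^ k)%N.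
  rewrite card_imset // cardsT card_tuple; congr (_ ^ k)%N.
  by rewrite -cardsT; have := card_isog (isog_subg N) => ->.
apply: subset_leq_card; apply/subsetP => t /imsetP[u _ ->]; rewrite inE.
apply/andP; split.
  apply/allP => x /tnthP[i ->]; rewrite tnth_mktuple groupM //.
  by rewrite (subsetP sNG) ?subgP.
apply/eqP/eq_from_tnth => i; rewrite tnth_map tnth_mktuple.
have uN := subgP (tnth u i).
have nuN := subsetP (normG N) _ uN.
rewrite (morphM (coset_morphism N) (nt0 i) nuN) /=.
by rewrite (coset_id uN) mulg1 t0s.
Qed.

(** A lift of a generating tuple of [G / N] generates a supplement of [N], that is, [G] or a
    complement; a complement contains at most one lift of a given tuple. *)
Lemma leq_n_gen_tuples_quotient k :
  n_gen_tuples (G / N)%G k * (#|N| ^ k - #|[complements to N in G]|)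
    <= n_gen_tuples G k.
Proof.
apply: (leq_mul_card_fibres (f := map_tuple (coset N))) => s.
rewrite inE => /andP[sG /eqP genS].
rewrite leq_subLR; apply: leq_trans (card_tuple_coset_fibre sG) _.
(* [A] holds all lifts of [s] with entries in [G], [B] those that generate [G]; [gn] will map
   [A :\: B] injectively to the complements. *)
set B := (X in _ + #|pred_of_set X|); set A := (X in #|pred_of_set X| <= _).
rewrite -(cardsID B A) addnC leq_add ?subset_leq_card ?subsetIr //.
pose gn (t : k.-tuple gT) := <<[set x in t]>>%G.
have AD t : t \in A :\: B -> [/\ all (fun x => x \in G) t,
    map_tuple (coset N) t = s & gn t \in [complements to N in G]].
  move=> tAB; rewrite !inE in tAB.
  case/andP: tAB => + /andP[tG ts]; rewrite tG ts andbT /= => ng.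
  split=> //; first exact/eqP.
  apply: minnormal_supplement_complement => //=.
  have tN : all (fun x => x \in 'N(N)) t.
    by apply/allP=> x /(allP tG) /(subsetP nNG).
  have := quotient_gen_tuple tN; rewrite (eqP ts) genS => eqQ.
  have sgG : <<[set x in t]>> \subset G.
    by rewrite gen_subG; apply/subsetP=> x; rewrite inE => /(allP tG).
  by rewrite -quotientK ?(subset_trans sgG) // -eqQ quotientGK // /normal sNG.
have injg : {in A :\: B &, injective gn}.
  move=> t1 t2 /AD[t1G ts1 /complP[tiN _]] /AD[t2G ts2 _] eqg.
  apply/eq_from_tnth => i.
  have c12 : coset N (tnth t1 i) = coset N (tnth t2 i).
    have := congr1 (fun u => tnth u i) (etrans ts1 (esym ts2)).
    by rewrite !tnth_map.
  have [i1 i2] : tnth t1 i \in G /\ tnth t2 i \in G.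
    by split; [apply: (allP t1G)|apply: (allP t2G)]; exact: mem_tnth.
  apply: (compl_coset_inj tiN _ _ _ _ c12); rewrite ?(subsetP nNG) //=.
    by rewrite mem_gen ?inE ?mem_tnth.
  rewrite (congr1 (@gval gT) eqg : <<[set x in t1]>> = <<[set x in t2]>>).
  by rewrite mem_gen ?inE ?mem_tnth.
rewrite -(card_in_imset injg); apply: subset_leq_card.
by apply/subsetP => M /imsetP[t /AD[_ _ ?] ->].
Qed.
End GeneratingTuples.

(** * Generator ranks of [p]-groups *)

Section RankPGroup.
Local Open Scope group_scope.
Implicit Type gT : finGroupType.

Lemma grank_lift gT (A K : {group gT}) : K <| A ->
  {B : {set gT} | K <*> B = A & #|B| <= 'm(A / K)}.
Proof.
move=> nsKA; have [sKA nKA] := andP nsKA.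
have [/= Bb defA <-] := grank_witness (A / K).
exists [set repr (set_of_coset x) | x in Bb]; last exact: leq_imset_card.
set B := [set _ | _ in _].
have nB : B \subset 'N(K).
  by apply/subsetP=> _ /imsetP[x _ ->]; apply: repr_coset_norm.
have BK : B / K = Bb.
  rewrite quotientE morphimEsub // -imset_comp.
  rewrite (eq_imset (g := id)) ?imset_id // => x /=; exact: coset_reprK.
have sgN : <<B>> \subset 'N(K) by rewrite gen_subG.
rewrite -joing_idr norm_joinEr // -quotientK // quotient_gen // BK defA.
by rewrite quotientGK.
Qed.

Variable p : nat.

Lemma grank_abelem gT (A : {group gT}) : p.-abelem A -> 'm(A) = logn p #|A|.
Proof.
by move=> abA; rewrite grank_abelian ?(abelem_abelian abA) // (rank_abelem abA).
Qed.

(** Burnside's basis theorem: lifts of generators of the elementary abelian [P / 'Phi(P)] generate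
    [P], since ['Phi(P)] consists of non-generators. *)
Lemma expn_grank_pgroup gT (P : {group gT}) :
  p.-group P -> (p ^ 'm(P))%N = #|P : 'Phi(P)|.
Proof.
move=> pP; have nPhi := Phi_normal P.
have abQ := Phi_quotient_abelem pP.
rewrite -card_quotient ?normal_norm // (card_pgroup (abelem_pgroup abQ)).
congr (p ^ _)%N; rewrite -grank_abelem //.
apply/eqP; rewrite eqn_leq quotient_grank ?normal_norm // andbT.
have [B defP leB] := grank_lift nPhi.
by rewrite -{1}(Phi_nongen defP) (leq_trans (grank_min B)).
Qed.

Lemma expn_grank_quotient gT (P N : {group gT}) : p.-group P -> N <| P ->
  (p ^ 'm(P / N))%N = #|P : N <*> 'Phi(P)|.
Proof.
move=> pP /andP[sNP nNP].
have sFP := Phi_sub P; have nNF := subset_trans sFP nNP.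
rewrite expn_grank_pgroup ?quotient_pgroup // -(quotient_Phi pP) //.
rewrite -(quotientYidl nNF) /= index_quotient_eq ?join_subG ?sNP //.
by rewrite (subset_trans (subsetIr _ _)) ?joing_subl.
Qed.

Lemma expn_grank_split gT (P N : {group gT}) : p.-group P -> N <| P ->
  (p ^ 'm(P))%N = (p ^ 'm(P / N) * #|N <*> 'Phi(P) : 'Phi(P)|)%N.
Proof.
move=> pP nsNP; rewrite expn_grank_quotient // expn_grank_pgroup //.
by rewrite Lagrange_index ?joing_subr // join_subG normal_sub ?Phi_sub.
Qed.

(** If the rank did not drop, [N] would lie in ['Phi(P)], and the complement [Q] would satisfy
    [Q <*> 'Phi(P) = P], hence [Q = P], against [N :&: Q = 1]. *)
Lemma grank_complement gT (P N : {group gT}) :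
  prime p -> p.-group P -> N <| P -> N :!=: 1 ->
  [splits P, over N] -> 'm(P / N) < 'm(P).
Proof.
move=> p_pr pP nsNP ntN /splitsP[Q /complP[tiNQ NQ]].
rewrite -(ltn_exp2l _ _ (prime_gt1 p_pr)) (expn_grank_split pP nsNP).
rewrite ltn_Pmulr ?expn_gt0 ?prime_gt0 // indexg_gt1.
apply: contra ntN; rewrite join_subG => /andP[sNF _].
suff /setIidPl <- : N \subset Q by rewrite tiNQ.
suff -> : Q :=: P by exact: normal_sub.
have nNQ : Q \subset 'N(N).
  by rewrite (subset_trans _ (normal_norm nsNP)) // -NQ mulG_subr.
rewrite -[LHS]genGid; apply: Phi_nongen; apply/eqP.
rewrite eqEsubset join_subG Phi_sub -{1 2}NQ mulG_subr /=.
by rewrite mulG_subG joing_subr (subset_trans sNF) ?joing_subl.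
Qed.

(** [P] is a central product of [N] and [Q], so ['Phi(P)] is the product of ['Phi(N) = 1] and
    ['Phi(Q)]. *)
Lemma Phi_sub_central_complement gT (P N Q : {group gT}) :
  p.-group P -> p.-abelem N ->
  P \subset 'C(N) -> Q \in [complements to N in P] -> 'Phi(P) \subset Q.
Proof.
move=> pP abN cNP /complP[tiNQ NQ].
have cNQ : Q \subset 'C(N) by rewrite (subset_trans _ cNP) // -NQ mulG_subr.
have := Phi_cprod pP (etrans (cprodE cNQ) NQ).
rewrite (eqP (_ : 'Phi(N) == 1)) ?(trivg_Phi (abelem_pgroup abN)) //.
by rewrite cprod1g => <-; apply: Phi_sub.
Qed.

Lemma grank_central_complement gT (P N : {group gT}) :
    p.-group P -> N <| P -> p.-abelem N -> P \subset 'C(N) -> [splits P, over N] ->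
  (p ^ 'm(P))%N = (p ^ 'm(P / N) * #|N|)%N.
Proof.
move=> pP nsNP abN cNP /splitsP[Q cQ].
rewrite (expn_grank_split pP nsNP); congr (_ * _)%N.
have tiNF : N :&: 'Phi(P) = 1.
  have := setIS N (Phi_sub_central_complement pP abN cNP cQ).
  by have [-> _] := complP cQ => /trivgP.
have sFP := Phi_sub P; have nNF := subset_trans sFP (normal_norm nsNP).
rewrite -divgS ?joing_subr //= joingC norm_joinEl //.
by rewrite TI_cardMg 1?setIC // mulKn ?cardG_gt0.
Qed.
End RankPGroup.

(** * Complements of a normal subgroup: their determination by generators and their conjugacy *)

Section CountComplements.
Local Open Scope group_scope.
Variable gT : finGroupType.
Implicit Types G K L M N P R D : {group gT}.

(** A complement [L] in [C] is determined by the [N]-components [divgr N L b] of the [b] in [B]; the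
    elements of [F], common to all members of [C], cost nothing in the count. *)
Lemma card_complements_over R N (F B : {set gT}) (C : {set {group gT}}) :
    R \subset 'N(N) -> N <*> (F :|: B) = R ->
    {in C, forall L, L \in [complements to N in R] /\ F \subset L} ->
  #|C| <= #|N| ^ #|B|.
Proof.
move=> nNR defR CL.
have sBR : B \subset R by rewrite -defR sub_gen // !subsetU ?subxx ?orbT.
pose h L := [ffun b => if b \in B then divgr N L b else 1].
have injh : {in C &, injective h}.
  move=> L1 L2 /CL[/complP[ti1 e1] F1] /CL[/complP[ti2 e2] F2] eqh.
  suff half (K1 K2 : {group gT}) : N :&: K1 = 1 -> N * K1 = R -> F \subset K1 ->
     N * K2 = R -> F \subset K2 -> h K1 = h K2 -> K1 \subset K2.
    by apply/val_inj/eqP; rewrite eqEsubset !half.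
  move=> ti eK1 sF1 eK2 sF2 /ffunP eq12.
  have nI : K1 :&: K2 \subset 'N(N).
    by rewrite subIset // (subset_trans _ nNR) // -eK1 mulG_subr.
  have : R \subset N * (K1 :&: K2).
    rewrite -(norm_joinEr nI) -defR join_subG joing_subl subUset.
    rewrite (subset_trans _ (joing_subr _ _)) ?subsetI ?sF1 //=.
    rewrite norm_joinEr //; apply/subsetP => b Bb.
    have bR := subsetP sBR _ Bb.
    have := eq12 b; rewrite !ffunE Bb => eqd.
    have eqr : remgr N K1 b = remgr N K2 b.
      by apply: (mulgI (divgr N K1 b)); rewrite {2}eqd -!divgr_eq.
    rewrite (divgr_eq N K1 b) mem_mulg ?mem_divgr ?eK1 // inE.
    by rewrite mem_remgr ?eK1 // eqr mem_remgr ?eK2.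
  (* By Dedekind's law the right side is [(N :&: K1) * (K1 :&: K2)], that is [K1 :&: K2]. *)
  move=> sR; have : K1 \subset K1 :&: (N * (K1 :&: K2)).
    by rewrite subsetI subxx (subset_trans _ sR) // -eK1 mulG_subr.
  rewrite -group_modr ?subsetIl // setIC ti mul1g => /subset_trans; apply.
  exact: subsetIr.
rewrite -(card_in_imset injh) -(card_pffun_on 1 (mem B) (mem N)).
apply: subset_leq_card; apply/subsetP => _ /imsetP[L /CL[/complP[_ eL] _] ->].
apply/pffun_onP; split.
  by apply/subsetP => b; rewrite inE ffunE; case: (b \in B); rewrite ?eqxx.
move=> _ /imageP[b Bb ->]; rewrite ffunE (_ : b \in B = true) //.
by rewrite mem_divgr // eL (subsetP sBR).
Qed.

Lemma card_complements P N : N <| P ->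
  #|[complements to N in P]| <= #|N| ^ 'm(P / N).
Proof.
move=> nsNP; have [B defP leB] := grank_lift nsNP.
apply: leq_trans (_ : #|N| ^ #|B| <= _); last by rewrite leq_pexp2l ?cardG_gt0.
apply: (@card_complements_over P N set0) => [||L cL].
- exact: normal_norm.
- by rewrite set0U.
- by rewrite sub0set.
Qed.

(** Gaschuetz's theorem supplies a conjugating [x] in [N]. It normalises the common trace [K :&: P],
    so its commutators with that trace lie in [N :&: K = 1]; as [N] is abelian and
    [P = N * (K :&: P)], [x] centralises [P]. *)
Lemma Gaschutz_transitive_cent G N P : N <| G -> N \subset P -> P \subset G ->
    abelian N -> coprime #|N| #|G : P| ->
  {in [complements to N in G] &, forall K L : {group gT},
    K :&: P = L :&: P -> exists2 x, x \in 'C_N(P) & L :=: K :^ x}.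
Proof.
move=> nsNG sNP sPG abN co K L cK cL eqP.
have [x Nx defL] := Gaschutz_transitive nsNG sNP sPG abN co cK cL eqP.
exists x => //; rewrite inE Nx /=.
have [tiNK NK] := complP cK.
have defP : N * (K :&: P) = P by rewrite group_modl // NK; apply/setIidPr.
have nNx : x \in 'N(N) by rewrite (subsetP (normG N)).
have nQx : x \in 'N(K :&: P).
  apply/normP; rewrite conjIg -defL (conjGid (subsetP sNP _ Nx)).
  by rewrite -eqP.
rewrite -defP centM inE (subsetP abN) //=.
have nNQ : K :&: P \subset 'N(N).
  by rewrite subIset // (subset_trans _ (normal_norm nsNG)) // -NK mulG_subr.
apply/centP => y Qy; apply/commgP; rewrite -in_set1 -[[set 1]]/(1 : {set gT}).
rewrite -tiNK inE; apply/andP; split.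
  by rewrite commgEl groupM ?groupV // memJ_norm ?(subsetP nNQ).
have Qyx : y^-1 ^ x \in K :&: P by rewrite memJ_norm ?groupV.
by move: Qyx Qy; rewrite commgEr !inE => /andP[? _] /andP[? _]; rewrite groupM.
Qed.
Lemma complement_setI G N P K :
  N \subset P -> P \subset G -> K \in [complements to N in G] ->
  (K :&: P)%G \in [complements to N in P].
Proof.
move=> sNP sPG /complP[tiNK NK]; apply/complP; split; rewrite /=.
  by rewrite setIA tiNK (setIidPl (sub1G _)).
by rewrite group_modl // NK; apply/setIidPr.
Qed.

End CountComplements.

(** * Counting complements by their traces on a Sylow subgroup *)

Section CountComplementsSylow.
Local Open Scope group_scope.
Variable gT : finGroupType.
Implicit Types G K L M N P R D : {group gT}.

Lemma card_restriction_fibre G N P (C : {set {group gT}}) (Q : {group gT}) :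
    N <| G -> N \subset P -> P \subset G -> abelian N -> coprime #|N| #|G : P| ->
    C \subset [complements to N in G] ->
  #|[set K in C | (K :&: P)%G == Q]| <= #|'C_N(P)|.
Proof.
move=> nsNG sNP sPG abN co sC.
set A := [set K in C | _]; have [-> | [K AK]] := set_0Vmem A.
  by rewrite cards0.
apply: leq_trans (leq_imset_card (fun x => (K :^ x)%G) 'C_N(P)).
apply: subset_leq_card; apply/subsetP => L AL.
move: AK AL; rewrite !inE => /andP[KC /eqP eK] /andP[LC /eqP eL].
have [|x Cx defL] := Gaschutz_transitive_cent nsNG sNP sPG abN co
  (subsetP sC _ KC) (subsetP sC _ LC).
  by have := congr1 (@gval gT) (etrans eK (esym eL)).
by apply/imsetP; exists x => //; apply: val_inj.
Qed.

(** The first factor bounds the number of traces on [P], the second the number of complements with a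
    given trace. *)
Lemma card_complements_Gaschutz G N P :
    N <| G -> N \subset P -> P \subset G -> abelian N -> coprime #|N| #|G : P| ->
  #|[complements to N in G]| <= #|N| ^ 'm(P / N) * #|'C_N(P)|.
Proof.
move=> nsNG sNP sPG abN co.
have nsNP : N <| P by rewrite (normalS sNP sPG).
apply: leq_trans (_ : #|[complements to N in P]| * #|'C_N(P)| <= _); last first.
  by rewrite leq_mul2r card_complements ?orbT.
apply: (leq_card_mul_fibres (f := fun K => (K :&: P)%G)) => [K|Q _].
  exact: complement_setI.
exact: (card_restriction_fibre Q nsNG sNP sPG abN co (subxx _)).
Qed.

(** Complements with the same trace are conjugate under [N], which here centralises them; so the
    factor [#|'C_N(P)|] disappears. *)
Lemma card_complements_central G N P :
    N <| G -> N \subset P -> P \subset G -> coprime #|N| #|G : P| ->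
    G \subset 'C(N) ->
  #|[complements to N in G]| <= #|N| ^ 'm(P / N).
Proof.
move=> nsNG sNP sPG co cNG.
have nsNP : N <| P by rewrite (normalS sNP sPG).
have abN : abelian N by rewrite /abelian (subset_trans (normal_sub nsNG)).
apply: leq_trans (card_complements nsNP).
have injf : {in [complements to N in G] &, injective (fun K => (K :&: P)%G)}.
  move=> K L cK cL /(congr1 (@gval gT)) eKL.
  have [x Nx defL] := Gaschutz_transitive nsNG sNP sPG abN co cK cL eKL.
  apply: val_inj => /=; rewrite defL; apply/esym/normP.
  have [_ NK] := complP cK.
  apply: (subsetP (cents_norm _)) Nx.
  by rewrite centsC (subset_trans _ cNG) // -NK mulG_subr.
rewrite -(card_in_imset injf); apply: subset_leq_card.
by apply/subsetP => _ /imsetP[K cK ->]; apply: complement_setI cK.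
Qed.

(* Two complements [M1 != M2] with the same trace [E] would make [E] normal in [G]
   and [G / E] a [p]-group of order at most [p ^ 2], hence abelian, so [N] central. *)
Lemma complement_setI_inj G N D p :
    prime p -> #|N| = p -> N <| G -> D <| G -> N \subset D -> #|G : D| = p ->
    ~~ (G \subset 'C(N)) ->
  {in [complements to N in G] &, injective (fun K => (K :&: D)%G)}.
Proof.
move=> p_pr oN nsNG nsDG sND iD ncN M1 M2 cM1 cM2 /(congr1 (@gval gT)) /= eE.
apply: contraNeq ncN => neM.
set E := (M1 :&: D)%G.
have [[ti1 e1] [ti2 e2]] := (complP cM1, complP cM2).
have [sNG nNG] := andP nsNG; have [sDG nDG] := andP nsDG.
have sM1G : M1 \subset G by rewrite -e1 mulG_subr.
have sM2G : M2 \subset G by rewrite -e2 mulG_subr.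
have nE1 : M1 \subset 'N(E) by rewrite normsI ?normG // (subset_trans sM1G).
have nE2 : M2 \subset 'N(E).
  by rewrite /= eE normsI ?normG // (subset_trans sM2G).
have oM12 : #|M1| = #|M2|.
  have := congr1 (fun A : {set gT} => #|A|) (etrans e1 (esym e2)).
  by rewrite !TI_cardMg // => /eqP; rewrite eqn_pmul2l ?cardG_gt0 // => /eqP.
have [m2 m2M2 m2nM1] : exists2 m, m \in M2 & m \notin M1.
  apply/subsetPn; apply: contra neM => s21.
  by rewrite eq_sym -val_eqE eqEcard s21 oM12 /=.
(* An element of [M2] outside [M1] has a non-trivial [N]-component, which normalises [E]; as [#|N|]
   is prime, all of [N] does. *)
have nEN : N \subset 'N(E).
  apply: prime_meetG; rewrite ?oN //.
  have /mulsgP[n m nN mM1 em2] : m2 \in N * M1 by rewrite e1 (subsetP sM2G).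
  apply/trivgPn; exists n.
    rewrite inE nN; have -> : n = m2 * m^-1 by rewrite em2 mulgK.
    by rewrite groupM ?groupV ?(subsetP nE2 _ m2M2) ?(subsetP nE1 _ mM1).
  by apply: contraNneq m2nM1 => n1; rewrite em2 n1 mul1g.
have nEG : G \subset 'N(E) by rewrite -e1 mulG_subG nEN.
have iE : #|M1 : E| %| p.
  rewrite -iD -(card_quotient nE1) /= setIC.
  rewrite (card_isog (second_isog (subset_trans sM1G nDG))).
  by rewrite -(card_quotient nDG) cardSg ?quotientS.
have oGE : #|G / E| = (p * #|M1 : E|)%N.
  rewrite card_quotient // -(@Lagrange_index _ G M1 E) ?subsetIl //.
  by rewrite -(divgS sM1G) -e1 TI_cardMg // oN mulnK ?cardG_gt0.
have pGE : p.-group (G / E).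
  rewrite /pgroup oGE pnatM pnat_id //=.
  by apply: pnat_dvd iE _; rewrite pnat_id.
have abGE : abelian (G / E).
  apply: (p2group_abelian pGE); rewrite oGE.
  rewrite (leq_trans (dvdn_leq_log p _ (_ : _ %| (p ^ 2)%N))) ?pfactorK //.
    by rewrite expn_gt0 prime_gt0.
  by rewrite expnS expn1 dvdn_pmul2l ?prime_gt0.
rewrite centsC; apply/commG1P/trivgP; rewrite -ti1 subsetI.
rewrite commg_subl nNG /= (subset_trans _ (subsetIl M1 D)) //.
by apply: subset_trans (der1_min nEG abGE); rewrite commSg.
Qed.

(** The general bound is [p ^ ('m(P / N) + 1)], so one factor [p] must be saved. Complements are
    replaced by their traces on [D], without loss by injectivity, and these are restricted to the
    Sylow subgroup [R] of [D]. The traces on [R] all contain ['Phi(P)], so they are fixed by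
    generators of [R] modulo [N <*> 'Phi(P)], one fewer than ['m(P / N)]; each fibre has at most [p]
    elements. *)
Lemma card_complements_prime G N P D p :
    prime p -> #|N| = p -> N <| G -> p.-Sylow(G) P -> D <| G -> N \subset D ->
    #|G : D| = p -> ~~ (G \subset 'C(N)) ->
  #|[complements to N in G]| <= p ^ 'm(P / N).
Proof.
move=> p_pr oN nsNG sylP nsDG sND iD ncN.
have pN : p.-group N by rewrite /pgroup oN pnat_id.
have abN : abelian N by rewrite cyclic_abelian ?prime_cyclic ?oN.
have sNP : N \subset P.
  by rewrite (normal_sub_max_pgroup (Hall_max sylP)).
have [sNG nNG] := andP nsNG; have [sDG nDG] := andP nsDG.
have sPG := pHall_sub sylP; have pP := pHall_pgroup sylP.
have nsNP : N <| P by rewrite (normalS sNP sPG).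
have abeN : p.-abelem N by exact: prime_abelem.
have ntN : N :!=: 1 by rewrite -cardG_gt1 oN prime_gt1.
have cNP : P \subset 'C(N).
  rewrite centsC; apply: subset_trans (subsetIr P _).
  by apply: (@prime_meetG _ N 'Z(P)%G); rewrite ?oN ?meet_center_nil ?(pgroup_nil pP).
pose R := (D :&: P)%G.
have sylR : p.-Sylow(D) R := Sylow_setI_normal nsDG sylP.
have sRP : R \subset P := subsetIr _ _.
have sNR : N \subset R by rewrite subsetI sND.
have coR : coprime #|N| #|D : R|.
  by case/and3P: sylR => _ _; apply: pnat_coprime.
pose C := [set (K :&: D)%G | K in [complements to N in G]].
have <- : #|C| = #|[complements to N in G]|.
  by rewrite card_in_imset //; apply: complement_setI_inj oN nsNG nsDG sND iD ncN.
have sC : C \subset [complements to N in D].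
  by apply/subsetP => _ /imsetP[K cK ->]; exact: complement_setI sND sDG cK.
pose T := [set (K :&: R)%G | K in C].
have iR : #|P : R| = p.
  rewrite -divgS // (card_Hall sylP) (card_Hall sylR) -(Lagrange sDG) iD.
  by rewrite partnM ?cardG_gt0 ?prime_gt0 //
     (part_pnat_id (pnat_id p_pr)) mulKn ?part_gt0.
have nsRP : R <| P by rewrite /= setIC (normalGI sPG nsDG).
have sFR : 'Phi(P) \subset R.
  apply: (Phi_min pP (normal_norm nsRP)).
  by rewrite prime_abelem // card_quotient ?normal_norm.
pose K0 := (N <*> 'Phi(P))%G.
have sK0R : K0 \subset R by rewrite join_subG sNR.
have nsK0P : K0 <| P by rewrite normalY ?Phi_normal.
have nsK0R : K0 <| R by rewrite (normalS sK0R sRP).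
have [B defR leB] := grank_lift nsK0R.
(* [R / K0] has index [p] in the elementary abelian [P / K0], whose rank is ['m(P / N)]. *)
have oRK : 'm(P / N) = ('m(R / K0)).+1.
  have abR : p.-abelem (R / K0).
    apply: abelemS (quotientS K0 sRP) _.
    rewrite -trivg_Phi ?quotient_pgroup // -(quotient_Phi pP) ?normal_norm //.
    by rewrite -subG1 quotient_sub1 ?joing_subr // (subset_trans (Phi_sub P)) ?normal_norm.
  apply: (expnI (prime_gt1 p_pr)); rewrite (expn_grank_quotient pP nsNP) expnS.
  rewrite (grank_abelem abR) -(card_pgroup (abelem_pgroup abR)).
  by rewrite card_quotient ?normal_norm // -{1}iR Lagrange_index.
have leT : #|T| <= p ^ 'm(R / K0).
  apply: leq_trans (_ : p ^ #|B| <= _); last by rewrite leq_pexp2l ?prime_gt0.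
  rewrite -oN; apply: (@card_complements_over _ R N 'Phi(P)).
  - exact: subset_trans sRP (normal_norm nsNP).
  - by rewrite -defR /= -[N <*> 'Phi(P)]/(<<N :|: 'Phi(P)>>) joing_idl /joing setUA.
  move=> _ /imsetP[_ /imsetP[K cK ->] ->]; split.
    exact: complement_setI sNR (pHall_sub sylR) (complement_setI sND sDG cK).
  have := Phi_sub_central_complement pP abeN cNP (complement_setI sNP sPG cK).
  by rewrite /= !subsetI => /andP[-> ->]; rewrite andbT (subset_trans sFR) ?subsetIl.
rewrite oRK expnSr.
apply: leq_trans (leq_card_mul_fibres (f := fun K => (K :&: R)%G) (T := T) (m := p) _ _) _.
- by move=> K CK; apply/imsetP; exists K.
- move=> Q _; apply: leq_trans (card_restriction_fibre _ _ sNR _ abN coR sC) _.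
  + by rewrite (normalS sND sDG).
  + exact: pHall_sub sylR.
  + by rewrite -oN subset_leq_card ?subsetIl.
- by rewrite leq_mul2r leT orbT.
Qed.

End CountComplementsSylow.

(** * Normal subgroups of prime index and abelianisations *)

Section PrimeIndex.
Local Open Scope group_scope.

Lemma normal_index_quotient (gT : finGroupType) (G N : {group gT}) (n : nat) :
    N <| G ->
  (exists2 Db : {group coset_of N}, Db <| G / N & #|G / N : Db| = n) <->
  (exists2 D : {group gT}, D <| G /\ N \subset D & #|G : D| = n).
Proof.
move=> nsNG; split=> [[Db nsDb iDb] | [D [nsDG sND] iD]].
  have [D defD sND nsDG] := inv_quotientN nsNG nsDb.
  exists D => //; rewrite -iDb defD index_quotient_eq ?(normal_sub nsDG) ?(normal_norm nsNG) //.
  by rewrite (subset_trans (subsetIr _ _)).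
exists (D / N)%G; first exact: quotient_normal.
rewrite /= index_quotient_eq ?(normal_sub nsDG) ?(normal_norm nsNG) //.
by rewrite (subset_trans (subsetIr _ _)).
Qed.

(** Modulo its largest normal subgroup of order prime to [p], [A] is a non-trivial [p]-group; a
    maximal subgroup there is normal of index [p]. *)
Lemma abelian_prime_index (gT : finGroupType) (A : {group gT}) p :
  abelian A -> p \in \pi(#|A|) -> exists2 D : {group gT}, D <| A & #|A : D| = p.
Proof.
move=> abA piA; have p_pr : prime p by move: piA; rewrite mem_primes => /andP[].
have nilA := abelian_nil abA.
have hallH := nilpotent_pcore_Hall p^' nilA.
set H := 'O_p^'(A)%G in hallH *.
have nsHA : H <| A := pcore_normal _ _.
have pAH : p.-group (A / H).
  rewrite /pgroup card_quotient ?normal_norm //.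
  by case/and3P: hallH => _ _; rewrite pnatNK.
suff : exists2 Db : {group coset_of H}, Db <| A / H & #|A / H : Db| = p.
  by case/(normal_index_quotient _ nsHA) => D [? _] ?; exists D.
have [e1|[M maxM _]] := maximal_exists (sub1G (A / H)); last first.
  exists M; last exact: p_maximal_index maxM.
  exact: p_maximal_normal pAH maxM.
have oA : p \in \pi(#|H|).
  suff -> : H :=: A by [].
  apply/eqP; rewrite eqEsubset normal_sub //= -quotient_sub1 ?normal_norm //.
  by rewrite -e1.
have p'H := pHall_pgroup hallH.
by have := pnatPpi p'H oA; rewrite inE /= inE eqxx.
Qed.

(** This form is easy to move between [G] and its quotients. A normal subgroup of index [p] contains
    the derived subgroup because its quotient is cyclic. *)
Lemma mem_pi_der1P (gT : finGroupType) (G : {group gT}) p : prime p ->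
  reflect (exists2 D : {group gT}, D <| G & #|G : D| = p)
          (p \in \pi(#|G / G^`(1)|)).
Proof.
move=> p_pr; have nsG' := der_normal 1 G.
apply: (iffP idP) => [piG | [D nsDG iD]].
  have [Db nsDb iDb] := abelian_prime_index (der_abelian 0 G) piG.
  have [|D [? _] ?] := (normal_index_quotient p nsG').1; last by exists D.
  by exists Db.
have sG'D : G^`(1) \subset D.
  rewrite der1_min ?normal_norm // cyclic_abelian // prime_cyclic //.
  by rewrite card_quotient ?normal_norm // iD.
rewrite mem_primes p_pr cardG_gt0 card_quotient ?normal_norm //.
by rewrite -iD indexgS.
Qed.

Lemma mem_pi_quotient_der1P (gT : finGroupType) (G N : {group gT}) p :
    prime p -> N <| G ->
  reflect (exists2 D : {group gT}, D <| G /\ N \subset D & #|G : D| = p)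
          (p \in \pi(#|(G / N) / (G / N)^`(1)|)).
Proof.
move=> p_pr nsNG.
by apply: (iffP (mem_pi_der1P (G / N)%G p_pr)) => /(normal_index_quotient p nsNG).
Qed.

Variables (gT : finGroupType) (G N : {group gT}) (p : nat).
Hypotheses (p_pr : prime p) (minN : minnormal N G) (sNG : N \subset G).
Hypothesis (abN : p.-abelem N).

Let nNG : G \subset 'N(N). Proof. by case/mingroupP: minN => /andP[]. Qed.
Let nsNG : N <| G. Proof. by rewrite /normal sNG. Qed.

(** [N :&: D = 1] by minimality and [N * D = G] since the index is prime; [[~: D, N]] lies in
    [N :&: D], so both [D] and the abelian [N] centralise [N]. *)
Lemma prime_index_not_above (D : {group gT}) :
    D <| G -> #|G : D| = p -> ~~ (N \subset D) ->
  [/\ D \in [complements to N in G], #|N| = p & G \subset 'C(N)].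
Proof.
move=> nsDG iD nND; have [sDG nDG] := andP nsDG.
have tiND : N :&: D = 1.
  apply/eqP; apply: contraNT nND => ntI.
  case/mingroupP: minN => _ /(_ (N :&: D)%G) /=.
  rewrite ntI normsI // subsetIl => /(_ isT isT) <-.
  exact: subsetIr.
have maxD : N * D = G.
  have nND' : N \subset 'N(D) by rewrite (subset_trans sNG).
  apply/eqP; rewrite -(norm_joinEl nND') eqEcard join_subG sNG sDG /=.
  have sDJ : D \subset N <*> D by exact: joing_subr.
  have := @Lagrange_index _ G (N <*> D) D; rewrite join_subG sNG sDG iD.
  move=> /(_ isT sDJ) eqp.
  have /primeP[_ /(_ #|N <*> D : D|)] := p_pr.
  rewrite -eqp dvdn_mull // => /(_ isT) /orP[/eqP j1|].
    case/negP: nND; have := indexg_eq1 (N <*> D)%G D; rewrite j1 eqxx join_subG.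
    by case/esym/andP.
  rewrite -{1}[#|_ : _|]mul1n eqn_pmul2r ?indexg_gt0 // => /eqP i1.
  by rewrite -(Lagrange (_ : N <*> D \subset G)) ?join_subG ?sNG // -i1 muln1.
split; first exact/complP.
  have := congr1 (fun A : {set gT} => #|A|) maxD.
  rewrite TI_cardMg // -(Lagrange sDG) iD mulnC => /eqP.
  by rewrite eqn_pmul2l ?cardG_gt0 // => /eqP.
rewrite -maxD mulG_subG; apply/andP; split; first exact: (abelem_abelian abN).
apply/commG1P/trivgP; rewrite -tiND subsetI.
by rewrite commg_subr (subset_trans sDG nNG) commg_subl (subset_trans sNG nDG).
Qed.

(** Complements of a central [N] are normal of index [p]. For distinct [M1] and [M2],
    [N <*> (M1 :&: M2)] would be a normal subgroup of index [p] above [N]. *)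
Lemma card_complements_p'ab : #|N| = p ->
    G \subset 'C(N) -> p \notin \pi(#|(G / N) / (G / N)^`(1)|) ->
  #|[complements to N in G]| <= 1.
Proof.
move=> oN cNG p'ab; rewrite leqNgt; apply: contra p'ab.
case/card_gt1P => M1 [M2 [cM1 cM2 neM]].
have [[ti1 e1] [ti2 e2]] := (complP cM1, complP cM2).
have norm_compl (M : {group gT}) : N * M = G -> M <| G.
  move=> eM; rewrite /normal -eM mulG_subr mulG_subG normG andbT cents_norm //.
  by rewrite centsC (subset_trans _ cNG) // -eM mulG_subr.
have index_compl (M : {group gT}) : N :&: M = 1 -> N * M = G -> #|G : M| = p.
  move=> tiM eM; rewrite -divgS ?normal_sub ?norm_compl // -eM TI_cardMg // oN.
  by rewrite mulnK ?cardG_gt0.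
have [ns1 ns2] := (norm_compl _ e1, norm_compl _ e2).
have [i1 i2] := (index_compl _ ti1 e1, index_compl _ ti2 e2).
have [[s1 n1] [s2 n2]] := (andP ns1, andP ns2).
set E := (M2 :&: M1)%G.
have sE1 : E \subset M1 := subsetIr _ _.
have iE : #|M1 : E| = p.
  have dE : #|M1 : E| %| p.
    rewrite -card_quotient ?normsI ?normG ?(subset_trans s1) //.
    rewrite (card_isog (second_isog (subset_trans s1 n2))).
    by rewrite -i2 -(card_quotient n2) cardSg ?quotientS.
  have /primeP[_ /(_ _ dE) /orP[|/eqP//]] := p_pr.
  rewrite indexg_eq1 subsetI subxx andbT => s12; case/eqP: neM.
  apply: val_inj; apply/eqP; rewrite eqEcard s12 /=.
  rewrite -(leq_pmul2r (prime_gt0 p_pr)) -{1}i2 -i1 mulnC Lagrange //.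
  by rewrite mulnC Lagrange.
have tiE : N :&: E = 1 by rewrite /= setIA ti2 (setIidPl (sub1G _)).
have nNE : E \subset 'N(N) by rewrite (subset_trans sE1) // (subset_trans s1).
apply/(mem_pi_quotient_der1P p_pr nsNG); exists (N <*> E)%G.
  by rewrite normalY ?normalI ?joing_subl.
rewrite -divgS ?join_subG ?sNG ?(subset_trans sE1) //= norm_joinEr // TI_cardMg //.
rewrite -(Lagrange s1) i1 -(Lagrange sE1) iE oN.
by rewrite [X in _ %/ X]mulnC mulKn // muln_gt0 cardG_gt0 prime_gt0.
Qed.

(** The sides can differ only through a normal subgroup of index [q] not containing [N], which
    forces [q = p] and [N] central. *)
Lemma mem_pi_der1_quotient (q : nat) : prime q ->
  ~~ (G \subset 'C(N)) || (q != p) ->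
  (q \in \pi(#|G / G^`(1)|)) = (q \in \pi(#|(G / N) / (G / N)^`(1)|)).
Proof.
move=> q_pr; apply: contraTeq => neq_pi.
have : (q \in \pi(#|G / G^`(1)|)) && (q \notin \pi(#|(G / N) / (G / N)^`(1)|)).
  move: neq_pi; case: (boolP (q \in \pi(#|(G / N) / _|))) => [|_].
    case/(mem_pi_quotient_der1P q_pr nsNG) => D [nsD _] iD.
    by rewrite (_ : (q \in _) = true) //; apply/(mem_pi_der1P _ q_pr); exists D.
  by case: (q \in _).
case/andP => /(mem_pi_der1P _ q_pr)[D nsD iD] /(mem_pi_quotient_der1P q_pr nsNG) nD.
have nND : ~~ (N \subset D) by apply/negP => sND; apply: nD; exists D.
have qp : q = p.
  have [sDG nDG] := andP nsD.
  have dI : #|N / D| %| q.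
    by rewrite -iD -(card_quotient nDG) cardSg ?quotientS.
  have pI : p.-group (N / D) by rewrite quotient_pgroup // abelem_pgroup.
  have /primeP[_ /(_ _ dI)] := q_pr; rewrite -trivg_card1.
  rewrite (_ : (N / D == 1) = false); last first.
    by apply: contraNF nND => /eqP N1; rewrite -quotient_sub1 ?N1 ?(subset_trans sNG).
  move=> /eqP oI; apply/eqP; move: pI; rewrite /pgroup oI.
  by rewrite pnatE // inE.
rewrite qp eqxx orbF negbK.
by case: (prime_index_not_above nsD (etrans iD qp) nND).
Qed.

End PrimeIndex.

Section NoncentralPrime.
Local Open Scope group_scope.
Variables (gT : finGroupType) (G N : {group gT}) (p : nat).

(** [G / 'C_G(N)] is non-trivial and embeds in [Aut N], which is abelian of order [p - 1]; [r] is
    the least prime divisor of its order. *)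
Lemma noncentral_prime_order : prime p -> #|N| = p -> N <| G ->
    ~~ (G \subset 'C(N)) ->
  exists2 r, r \in \pi(#|G / G^`(1)|) & r %| p.-1.
Proof.
move=> p_pr oN /andP[sNG nNG] ncN.
have nsC : 'C_G(N) <| G.
  by have := subcent_normal G N; rewrite (setIidPl nNG).
have cycN : cyclic N by rewrite prime_cyclic ?oN.
have isoG : G / 'C_G(N) \isog conj_aut N @* G.
  by rewrite -ker_conj_aut; exact: first_isog_loc.
have sA : conj_aut N @* G \subset Aut N.
  exact: Aut_conj_aut.
have abQ : abelian (G / 'C_G(N)).
  by rewrite (isog_abelian isoG) (abelianS sA) ?Aut_cyclic_abelian.
have ntQ : 1 < #|G / 'C_G(N)|.
  by rewrite cardG_gt1 -subG1 quotient_sub1 ?normal_norm // subsetI subxx.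
exists (pdiv #|G / 'C_G(N)|); last first.
  apply: dvdn_trans (pdiv_dvd _) _; rewrite (card_isog isoG).
  by rewrite -totient_prime // -oN -(card_Aut_cyclic cycN) cardSg.
have r_pr := pdiv_prime ntQ.
apply/(mem_pi_der1P _ r_pr).
have [|D nsD iD] := abelian_prime_index abQ (p := pdiv #|G / 'C_G(N)|).
  by rewrite mem_primes r_pr cardG_gt0 pdiv_dvd.
case: (normal_index_quotient (pdiv #|G / 'C_G(N)|) nsC) => [[]].
  by exists D.
by move=> E [? _] ? _; exists E.
Qed.
End NoncentralPrime.

(** * Sylow ranks and twisted primes *)

Section SylowRank.
Local Open Scope group_scope.
Implicit Types gT : finGroupType.

(** A Sylow subgroup always exists, so the default [1%G] is never taken; by conjugacy the choice
    does not matter. *)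
Definition sylow_rank gT (G : {group gT}) (p : nat) : nat :=
  'm(odflt 1%G [pick P : {group gT} | p.-Sylow(G) P]).

Lemma sylow_rankE gT (G P : {group gT}) p :
  p.-Sylow(G) P -> sylow_rank G p = 'm(P).
Proof.
move=> sylP; rewrite /sylow_rank; case: pickP => [Q sylQ | /(_ P)]; last by rewrite sylP.
have [x _ ->] := Sylow_trans sylP sylQ.
by rewrite -(isog_grank (conj_isog P x)).
Qed.

Lemma sylow_rank_quotient gT (G N : {group gT}) (p : nat) :
  N <| G -> p^'.-group N -> sylow_rank (G / N)%G p = sylow_rank G p.
Proof.
move=> /andP[sNG nNG] p'N; have [P sylP] := Sylow_exists p G.
have nNP := subset_trans (pHall_sub sylP) nNG.
rewrite (sylow_rankE sylP) (sylow_rankE (quotient_pHall nNP sylP)) /=.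
apply/esym/isog_grank/quotient_isog => //.
by rewrite setIC (coprime_TIg (pnat_coprime (pHall_pgroup sylP) p'N)).
Qed.

Lemma sylow_rank_gt0 gT (G : {group gT}) p :
  p \in \pi(#|G|) -> 0 < sylow_rank G p.
Proof.
move=> piG; have [P sylP] := Sylow_exists p G; rewrite (sylow_rankE sylP) lt0n.
apply: contraTneq piG => m0; have [B defP] := grank_witness P.
rewrite m0 => /eqP; rewrite cards_eq0 => /eqP B0; move: defP; rewrite B0 gen0 => P1.
have := card_Hall sylP; rewrite -P1 cards1 => /esym/eqP; rewrite p_part_eq1.
by [].
Qed.

Lemma sylow_rank1 gT p : sylow_rank (1%G : {group gT}) p = 0.
Proof.
have [P sylP] := Sylow_exists p (1%G : {group gT}); rewrite (sylow_rankE sylP).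
have /trivgP -> := pHall_sub sylP.
by apply/eqP; rewrite -leqn0 -[X in _ <= X](cards0 gT) -{1}gen0 grank_min.
Qed.

(* The exponent [e_p] of the header; in the induction [s] remains the list of primes
   dividing [|G/G'|] for the initial [G], while [G] runs through its quotients. *)
Definition twisted gT (s : seq nat) (G : {group gT}) (p : nat) : bool :=
  (p \notin \pi(#|G / G^`(1)|)) && has (fun r => r %| p.-1) s.
End SylowRank.

(** * Arithmetic of the product bound *)

Section Arith.

Lemma leq_prod_expB p k (a : bool) e d : e <= d ->
  \prod_(i < d) (p ^ k - p ^ (i + a)) <=
    \prod_(i < e) (p ^ k - p ^ (i + a)) * p ^ ((d - e) * k).
Proof.
move=> led; rewrite -(subnKC led) addKn; elim: (d - e) => [|g IHg].
  by rewrite addn0 mul0n muln1.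
rewrite addnS big_ord_recr /=.
have -> : p ^ (g.+1 * k) = p ^ (g * k) * p ^ k by rewrite mulSn addnC expnD.
rewrite mulnA.
by rewrite leq_mul // leq_subr.
Qed.

Lemma leq_prod_expB_lt p k (a : bool) e d : e < d ->
  \prod_(i < d) (p ^ k - p ^ (i + a)) <=
    \prod_(i < e) (p ^ k - p ^ (i + a)) * (p ^ k - p ^ (e + a))
      * p ^ ((d - e.+1) * k).
Proof. by move=> /(leq_prod_expB p k a); rewrite big_ord_recr. Qed.

(** Serves when [p] becomes twisted in [G / N]: the factor [p ^ k - 1] contributed by [N] is the
    missing first one. *)
Lemma prod_expB_shift p k e :
  \prod_(i < e) (p ^ k - p ^ (i + false)) * (p ^ k - p ^ (e + false)) =
  (p ^ k - 1) * \prod_(i < e) (p ^ k - p ^ (i + true)).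
Proof.
transitivity (\prod_(i < e.+1) (p ^ k - p ^ (i + false))).
  by rewrite big_ord_recr.
rewrite big_ord_recl /= expn0; congr (_ * _); apply: eq_bigr => i _.
by rewrite /= addn0 addn1.
Qed.

Lemma prod_expB_eq0 p k (a : bool) d : 0 < p -> 0 < d -> k < d + a ->
  \prod_(i < d) (p ^ k - p ^ (i + a)) = 0.
Proof.
case: d => // d p_gt0 _ lek; rewrite big_ord_recr /=.
by rewrite (eqP (_ : p ^ k - p ^ (d + a) == 0)) ?muln0 // subn_eq0 leq_pexp2l //; lia.
Qed.

(** Here [n] and [m] stand for the exponents of [#|N|] and [#|'C_N(P)|], [e] and [d] for the ranks
    of [P / N] and [P]. The claim is [m <= (n - 1) * (k - e)]: clear for [m < n] as [e < k], and for
    [m = n] because then [k - e >= n >= 2]. *)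
Lemma exponent_bound n m e k d : 1 < n -> e < d -> d <= k -> m <= n ->
  (m = n -> d = e + n) -> n * e + m + k <= n * k + e.
Proof.
move=> n_gt1 led ledk lemn eqmn.
have [u defk] : exists u, k = e + u.+1 by exists (k - e).-1; lia.
have [v defn] : exists v, n = v.+2 by exists (n - 2); lia.
have [lt_mn | ] := ltnP m n; first by rewrite defk defn in lt_mn *; nia.
move=> lenm; have /eqmn dE : m = n by lia.
have [w defu] : exists w, u = w.+1 by exists u.-1; lia.
by rewrite defk defu (_ : m = n) ?defn; [nia|lia].
Qed.
Lemma leq_mul_cross n c q b A C : n * b <= c * q -> n * (A * b * C) <= c * A * (q * C).
Proof.
move=> le_nb; rewrite (_ : n * (A * b * C) = n * b * (A * C)); last by lia.
by rewrite (_ : c * A * (q * C) = c * q * (A * C)) ?leq_mul2r ?le_nb ?orbT //; lia.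
Qed.

(** Combines the step for one [N] with the induction hypothesis: [b] and [b'] are the products at
    [p] for [G] and [G / N], [X] the product over the other primes, [c] is [#|N| ^ k] minus the
    number of complements. *)
Lemma leq_mul_chain gn n ng ngN pe Y X b b' c pg :
  n * b <= c * b' * pg -> ngN * c <= ng -> gn * (b' * X) <= ngN * (pe * Y) ->
  gn * n * (b * X) <= ng * (pe * pg * Y).
Proof.
move=> le_step le_ng IH.
apply: leq_trans (_ : gn * X * ((c * b') * pg) <= _).
  by rewrite (_ : gn * n * (b * X) = gn * X * (n * b)) ?leq_mul2l ?le_step ?orbT //; lia.
apply: leq_trans (_ : (ngN * (pe * Y)) * (c * pg) <= _).
  rewrite (_ : gn * X * (c * b' * pg) = gn * (b' * X) * (c * pg)); last by lia.
  by rewrite leq_mul2r IH orbT.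
rewrite (_ : ngN * (pe * Y) * (c * pg) = ngN * c * (pe * pg * Y)); last by lia.
by rewrite leq_mul2r le_ng orbT.
Qed.
End Arith.

(** * The lower bound for the number of generating tuples of [G] *)

Section LowerBound.
Local Open Scope group_scope.
Implicit Types gT : finGroupType.

(** With denominators cleared, [c / |N|^k] is at most the term [p^(d(P/N) + e_p - k)] of the first
    factor that is absent from the product for [G / N]. *)
Lemma card_complements_bound gT (G N P : {group gT}) p k (s : seq nat) :
    prime p -> minnormal N G -> N \subset G -> p.-abelem N -> p.-Sylow(G) P ->
    {subset \pi(#|G / G^`(1)|) <= s} -> [splits G, over N] ->
    'm(P) + twisted s G p <= k ->
  #|[complements to N in G]| * p ^ k <= #|N| ^ k * p ^ ('m(P / N) + twisted s G p).
Proof.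
move=> p_pr minN sNG abeN sylP sub_s splG lek.
have [/andP[ntN nNG] _] := mingroupP minN.
have nsNG : N <| G by rewrite /normal sNG.
have pN := abelem_pgroup abeN; have abN := abelem_abelian abeN.
have [sPG pP _] := and3P sylP.
have sNP : N \subset P by rewrite (normal_sub_max_pgroup (Hall_max sylP)).
have nsNP : N <| P by rewrite (normalS sNP sPG).
have co : coprime #|N| #|G : P|.
  by case/and3P: sylP => _ _; apply: pnat_coprime.
have splP : [splits P, over N] by rewrite -(Gaschutz_split nsNG sNP sPG abN co).
have lted : 'm(P / N) < 'm(P) by apply: (grank_complement p_pr pP).
have leG := card_complements_Gaschutz nsNG sNP sPG abN co.
have [oN | noN] := eqVneq #|N| p.
  rewrite oN mulnC leq_mul2l; apply/orP; right.
  have [cNG | ncN] := boolP (G \subset 'C(N)).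
    apply: leq_trans (card_complements_central nsNG sNP sPG co cNG) _.
    by rewrite oN leq_pexp2l ?prime_gt0 // leq_addr.
  (* As [r] divides [p - 1], either [p] is twisted, which allows the extra factor [p] of the general
     bound, or [p] divides the order of the derived quotient, and the sharper count applies. *)
  have [r r_pi r_dvd] := noncentral_prime_order p_pr oN nsNG ncN.
  have hs : has (fun r => r %| p.-1) s.
    by apply/hasP; exists r => //; apply: sub_s.
  rewrite /twisted hs andbT; case: (boolP (p \in _)) => /= [p_pi|_].
    rewrite addn0; move: p_pi.
    rewrite (@mem_pi_der1_quotient _ G N p) ?ncN //.
    case/(mem_pi_quotient_der1P p_pr nsNG) => D [nsD sND] iD.
    exact: (card_complements_prime p_pr oN nsNG sylP nsD sND iD ncN).
  rewrite addn1 expnSr; apply: leq_trans leG _.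
  by rewrite oN leq_mul2l -{2}oN subset_leq_card ?subsetIl ?orbT.
(* Now [#|N| = p ^ n] with [n > 1], and everything reduces to a comparison of exponents. *)
have oN := card_pgroup pN; set n := logn p #|N| in oN.
have sCN : 'C_N(P) \subset N := subsetIl _ _.
have oC := card_pgroup (pgroupS sCN pN); set m := logn p _ in oC.
apply: leq_trans (leq_mul leG (leqnn _)) _.
rewrite oC oN -!expnM -!expnD leq_pexp2l ?prime_gt0 //.
apply: leq_trans (_ : n * k + 'm(P / N) <= _); last by rewrite leq_add2l leq_addr.
apply: (@exponent_bound n m _ k 'm(P)) => //.
- have : 1 < #|N| by rewrite cardG_gt1.
  rewrite oN; case: (n) noN oN => [|[|//]] noN oN; rewrite ?expn0 // expn1.
  by case/eqP: noN; rewrite oN expn1.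
- by apply: leq_trans lek; rewrite leq_addr.
- by rewrite dvdn_leq_log ?cardG_gt0 ?cardSg.
move=> mn; have eCN : 'C_N(P) = N.
  by apply/eqP; rewrite eqEcard sCN oC oN mn /=.
have cNP : P \subset 'C(N) by rewrite centsC -{1}eCN subsetIr.
apply: (expnI (prime_gt1 p_pr)).
by rewrite (grank_central_complement pP nsNP abeN cNP splP) expnD -oN.
Qed.

(** The part of the induction step at [p]. Either [N] changes the twist, or it has no complement, or
    it has one and uses up the factor of index ['m(P / N)]. *)
Lemma leq_prod_expB_minnormal gT (G N P : {group gT}) p k (s : seq nat) :
    prime p -> minnormal N G -> N \subset G -> p.-abelem N -> p.-Sylow(G) P ->
    {subset \pi(#|G / G^`(1)|) <= s} ->
  #|N| ^ k * \prod_(i < 'm(P)) (p ^ k - p ^ (i + twisted s G p)) <=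
    (#|N| ^ k - #|[complements to N in G]|) *
    \prod_(i < 'm(P / N)) (p ^ k - p ^ (i + twisted s (G / N)%G p)) *
    p ^ (('m(P) - 'm(P / N)) * k).
Proof.
move=> p_pr minN sNG abeN sylP sub_s.
have [/andP[ntN nNG] _] := mingroupP minN.
have nsNG : N <| G by rewrite /normal sNG.
have pN := abelem_pgroup abeN; have abN := abelem_abelian abeN.
have [sPG pP _] := and3P sylP.
have sNP : N \subset P by rewrite (normal_sub_max_pgroup (Hall_max sylP)).
have nsNP : N <| P by rewrite (normalS sNP sPG).
have p_gt0 := prime_gt0 p_pr.
have led : 'm(P / N) <= 'm(P) by rewrite quotient_grank ?normal_norm.
have co : coprime #|N| #|G : P|.
  by case/and3P: sylP => _ _; apply: pnat_coprime.
have splGP := Gaschutz_split nsNG sNP sPG abN co.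
have rank_lt : [splits G, over N] -> 'm(P / N) < 'm(P).
  by rewrite splGP => splP; apply: (grank_complement p_pr pP).
(* A change of twist means that [p] divides the order of the derived quotient of [G] but not of
   [G / N]; then [N] is central of order [p] with a single complement. *)
have [tw | ntw] := eqVneq (twisted s (G / N)%G p) (twisted s G p); last first.
  have [p_pi p_npi] : p \in \pi(#|G / G^`(1)|) /\ p \notin \pi(#|(G / N) / (G / N)^`(1)|).
    move: ntw; rewrite /twisted; case: (has _ _); rewrite ?andbF ?andbT //.
    have : p \in \pi(#|(G / N) / (G / N)^`(1)|) -> p \in \pi(#|G / G^`(1)|).
      case/(mem_pi_quotient_der1P p_pr nsNG) => D [nsD _] iD.
      by apply/(mem_pi_der1P _ p_pr); exists D.
    by case: (p \in _) => [->|_] //; case: (p \in _).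
  have [D nsD iD] := mem_pi_der1P _ p_pr p_pi.
  have nND : ~~ (N \subset D).
    by apply: contra p_npi => sND; apply/(mem_pi_quotient_der1P p_pr nsNG); exists D.
  have [cD oN cNG] := prime_index_not_above p_pr minN sNG abeN nsD iD nND.
  have le1 := card_complements_p'ab p_pr minN sNG oN cNG p_npi.
  have lted : 'm(P / N) < 'm(P) by apply: rank_lt; apply/splitsP; exists D.
  have tw0 : twisted s G p = false by rewrite /twisted p_pi.
  have tw1 : twisted s (G / N)%G p by move: ntw; rewrite tw0; case: twisted.
  rewrite tw0 tw1 oN; apply: leq_trans (leq_mul (leqnn _) (leq_prod_expB_lt p k _ lted)) _.
  rewrite prod_expB_shift mulnC -mulnA -expnD addnC -mulSn -subSn // subSS.
  by rewrite !leq_mul // leq_sub2l.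
rewrite tw; have [splG | nsplG] := boolP [splits G, over N]; last first.
  rewrite (_ : #|[complements to N in G]| = 0); last first.
    by apply/eqP; rewrite cards_eq0; move: nsplG; rewrite negbK.
  by rewrite subn0 -mulnA leq_mul2l leq_prod_expB // orbT.
have lted := rank_lt splG.
(* For small [k] the last factor on the left truncates to [0]. *)
have [ltk | lek] := ltnP k ('m(P) + twisted s G p).
  by rewrite prod_expB_eq0 ?muln0 // (leq_ltn_trans _ lted).
have lec := card_complements_bound p_pr minN sNG abeN sylP sub_s splG lek.
apply: leq_trans (leq_mul (leqnn _) (leq_prod_expB_lt p k _ lted)) _.
have -> : (p ^ (('m(P) - 'm(P / N)) * k) = p ^ k * p ^ (('m(P) - ('m(P / N)).+1) * k))%N.
  by rewrite -expnD -mulSn -subSn.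
have {lec} : #|N| ^ k * (p ^ k - p ^ ('m(P / N) + twisted s G p)) <=
    (#|N| ^ k - #|[complements to N in G]|) * p ^ k.
  by rewrite mulnBr mulnBl leq_sub2l.
exact: leq_mul_cross.
Qed.

(** The lower bound for [P_G(k)] with denominators cleared. [L] and [s] stay fixed in the induction
    on [#|G|]; primes of [L] that no longer divide [#|G|] contribute empty products. *)
Lemma n_gen_tuples_lower_bound gT (G : {group gT}) k (s L : seq nat) :
    uniq L -> all prime L -> solvable G -> {subset \pi(#|G|) <= L} ->
    {subset \pi(#|G / G^`(1)|) <= s} ->
  #|G| ^ k * \prod_(p <- L) \prod_(i < sylow_rank G p) (p ^ k - p ^ (i + twisted s G p))
    <= n_gen_tuples G k * (\prod_(p <- L) p ^ sylow_rank G p) ^ k.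
Proof.
move=> uL prL; have [m] := ubnP #|G|; elim: m => // m IHm in gT G *.
rewrite ltnS => leGm solG sub_L sub_s.
have [G1 | ntG] := eqVneq G 1%G.
  rewrite G1 cards1 exp1n mul1n.
  rewrite big1 => [|p _]; last by rewrite sylow_rank1 big_ord0.
  rewrite big1 => [|p _]; last by rewrite sylow_rank1 expn0.
  rewrite exp1n muln1 card_gt0; apply/set0Pn; exists (nseq_tuple k 1).
  rewrite inE; apply/andP; split; first by apply/allP => x /nseqP[->]; rewrite group1.
  rewrite eqEsubset gen_subG sub1G andbT; apply/subsetP => x.
  by rewrite inE => /nseqP[->]; rewrite group1.
have [N minN sNG] : {N : {group gT} | minnormal N G & N \subset G}.
  by apply: minnormal_exists; rewrite ?normG.
have [nNG ntN] := minnormal_solvable minN sNG solG.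
case/is_abelemP => p p_pr abeN.
have nsNG : N <| G by rewrite /normal sNG.
have pN := abelem_pgroup abeN; have abN := abelem_abelian abeN.
have [P sylP] := Sylow_exists p G.
have nNP := subset_trans (pHall_sub sylP) nNG.
have pL : p \in L.
  apply: sub_L; rewrite mem_primes p_pr cardG_gt0 /=.
  have [//|_ pdN _] := pgroup_pdiv pN; exact: dvdn_trans pdN (cardSg sNG).
have piQ q : q \in \pi(#|(G / N) / (G / N)^`(1)|) -> q \in \pi(#|G / G^`(1)|).
  move=> q_pi; have q_pr : prime q by move: q_pi; rewrite mem_primes => /andP[].
  have [D [nsD _] iD] := mem_pi_quotient_der1P q_pr nsNG q_pi.
  by apply/(mem_pi_der1P _ q_pr); exists D.
have {IHm} IH : #|G / N| ^ k *
    \prod_(p <- L) \prod_(i < sylow_rank (G / N) p) (p ^ k - p ^ (i + twisted s (G / N)%G p))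
    <= n_gen_tuples (G / N)%G k * (\prod_(p <- L) p ^ sylow_rank (G / N) p) ^ k.
  apply: IHm (quotient_sol N solG) _ _ => [|q|q /piQ]; last exact: sub_s.
    by apply: leq_trans leGm; rewrite ltn_quotient.
  move=> q_pi; apply: sub_L; move: q_pi.
  by rewrite !mem_primes => /and3P[-> _ q_dvd]; rewrite cardG_gt0 (dvdn_trans q_dvd) ?dvdn_quotient.
(* At primes other than [p] neither rank nor twist changes in [G / N], so only the factor at [p] has
   to be compared. *)
have rank_q q : q != p -> sylow_rank (G / N) q = sylow_rank G q.
  move=> neq; apply: sylow_rank_quotient => //.
  by apply: sub_pgroup pN => r; rewrite !inE => /eqP->; rewrite eq_sym.
have tw_q q : prime q -> q != p -> twisted s (G / N)%G q = twisted s G q.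
  by move=> q_pr neq; rewrite /twisted (mem_pi_der1_quotient p_pr minN sNG abeN) // neq orbT.
have prodE (F F' : nat -> nat) : (forall q, prime q -> q != p -> F q = F' q) ->
    (\prod_(q <- L | q != p) F q = \prod_(q <- L | q != p) F' q)%N.
  move=> eqF; rewrite !(big_seq_cond (fun q => q != p)); apply: eq_bigr => q /andP[qL neq].
  by apply: eqF => //; apply: (allP prL).
move: IH; rewrite !(bigD1_seq p pL uL) /=.
rewrite (prodE _ (fun q => \prod_(i < sylow_rank G q) (q ^ k - q ^ (i + twisted s G q)))%N); last first.
  by move=> q q_pr neq; rewrite rank_q // tw_q.
rewrite (prodE (fun q => q ^ sylow_rank (G / N) q)%N (fun q => q ^ sylow_rank G q)%N); last first.
  by move=> q q_pr neq; rewrite rank_q.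
rewrite (sylow_rankE sylP) (sylow_rankE (quotient_pHall nNP sylP)) /=.
have le_ng := leq_n_gen_tuples_quotient minN sNG abN k.
have le_step := leq_prod_expB_minnormal k p_pr minN sNG abeN sylP sub_s.
have led : 'm(P / N) <= 'm(P) by rewrite quotient_grank.
have -> : (#|G| ^ k = #|G / N| ^ k * #|N| ^ k)%N.
  by rewrite -expnMn card_quotient // mulnC Lagrange.
have -> : (p ^ 'm(P) = p ^ 'm(P / N) * p ^ ('m(P) - 'm(P / N)))%N.
  by rewrite -expnD subnKC.
rewrite !expnMn -(expnM p (_ - _)).
exact: leq_mul_chain le_step le_ng.
Qed.
End LowerBound.

(** * Supersolubility of preimages *)

Section SupersolvablePreimage.
Local Open Scope group_scope.
Variables (aT rT : finGroupType) (f : {morphism [set: aT] >-> rT}).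
Hypothesis f_surj : f @* setT = setT.

Lemma morphpre_quotient_isog (A B : {group rT}) : A <| setT -> A \subset B ->
  (f @*^-1 B) / (f @*^-1 A) \isog B / A.
Proof.
move=> nsA sAB.
have dom : f @*^-1 B \subset f @*^-1 'N(A).
  by rewrite morphpreS // (subset_trans (subsetT B)) // normal_norm.
have := first_isog_loc (comp_morphism f (coset_morphism A)) dom.
rewrite ker_comp ker_coset morphim_comp morphpreK ?f_surj ?subsetT //.
by rewrite (setIidPr (morphpreS f sAB)).
Qed.

(** The series of the target is pulled back along [f], preceded by the preimage of [1], which is the
    cyclic kernel. *)
Lemma supersolvable_preimage :
  cyclic ('ker f) -> supersolvable [set: rT]%G -> supersolvable [set: aT]%G.
Proof.
move=> cycK [s [path_s last_s /allP nor_s]].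
pose g (A : {group rT}) := (f @*^-1 A)%G.
have norT (A : {group rT}) : A <| setT -> g A <| setT.
  by move=> nsA; rewrite -(morphpreT f) morphpre_normal ?f_surj ?subsetT.
exists (g 1%G :: map g s); split.
- rewrite /= sub1G /= -(isog_cyclic (quotient1_isog _)) cycK /=.
  have : (1%G : {group rT}) <| setT := normal1 _.
  move: path_s {last_s}; move: (1%G : {group rT}).
  elim: s nor_s => //= B s IHs nor_s A /andP[/andP[sAB cycBA] path_s] nsA.
  have nsB : B <| setT by apply: nor_s; rewrite mem_head.
  rewrite morphpreS //= (isog_cyclic (morphpre_quotient_isog nsA sAB)) cycBA /=.
  by apply: IHs => // C Cs; apply: nor_s; rewrite inE Cs orbT.
- rewrite /= last_map last_s; apply: val_inj; exact: morphpreT.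
- rewrite /= -[X in X && _]/(g 1%G <| setT) norT ?normal1 //=.
  by apply/allP => _ /mapP[A As ->]; apply: norT; apply: nor_s.
Qed.
End SupersolvablePreimage.

(** * Extensions by ['F_p] with scalar action through a multiplicative character *)

Definition mulcharacter (p : nat) (hT : finGroupType) (chi : hT -> 'F_p) : Prop :=
  chi 1%g = 1%R /\ forall a b, chi (a * b)%g = (chi a * chi b)%R.

Section ScalarExtension.
Local Open Scope ring_scope.
Variables (p : nat) (hT : finGroupType) (chi : hT -> 'F_p).

(** Crossed homomorphisms for the right action through [chi]; their graphs, the pairs [(d a, a)],
    are complements to ['F_p] in the extension below. *)
Definition derivations : {set {ffun hT -> 'F_p}} :=
  [set d : {ffun hT -> 'F_p} |
    [forall a, forall b, d (a * b)%g == d a * chi b + d b]].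

Lemma derivationP (d : {ffun hT -> 'F_p}) :
  reflect (forall a b, d (a * b)%g = d a * chi b + d b) (d \in derivations).
Proof.
rewrite inE; apply: (iffP forallP) => [H a b | H a].
  by have /forallP/(_ b)/eqP := H a.
by apply/forallP => b; rewrite H.
Qed.

Hypothesis chiP : mulcharacter chi.

Let chi1 : chi 1%g = 1. Proof. exact: chiP.1. Qed.
Let chiM a b : chi (a * b)%g = chi a * chi b. Proof. exact: chiP.2. Qed.

(** The carrier of the semidirect product. The proof of [mulcharacter chi] is a parameter of the
    type so that the group structure can be attached to it. *)
Definition scalar_ext of mulcharacter chi : Type := ('F_p * hT)%type.
Local Notation extT := (scalar_ext chiP).

HB.instance Definition _ := Finite.on extT.

Definition ext_mul (x y : extT) : extT := (x.1 * chi y.2 + y.1, (x.2 * y.2)%g).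
Definition ext_one : extT := (0, 1%g).
Definition ext_inv (x : extT) : extT := (- x.1 * chi x.2^-1%g, x.2^-1%g).

Lemma ext_mulA : associative ext_mul.
Proof.
move=> x y z; rewrite /ext_mul /= mulgA chiM.
by rewrite mulrDl mulrA addrA.
Qed.

Lemma ext_mul1 : left_id ext_one ext_mul.
Proof. by case=> v a; rewrite /ext_mul /= mul0r add0r mul1g. Qed.

Lemma ext_mulV : left_inverse ext_one ext_inv ext_mul.
Proof.
case=> v a; rewrite /ext_mul /ext_inv /= mulVg -mulrA -chiM mulVg chi1.
by rewrite mulr1 addNr.
Qed.

HB.instance Definition _ := Finite_isGroup.Build extT ext_mulA ext_mul1 ext_mulV.

Definition ext_proj (x : extT) : hT := x.2.

Lemma ext_projM : {in [set: extT] &, {morph ext_proj : x y / (x * y)%g}}.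
Proof. by []. Qed.
Canonical ext_proj_morphism := Morphism ext_projM.

Lemma ext_proj_surj : (ext_proj @* [set: extT] = [set: hT])%g.
Proof.
apply/setP => a; rewrite inE; apply/morphimP.
by exists ((0, a) : extT); rewrite ?inE.
Qed.

Hypothesis p_pr : prime p.

Lemma card_scalar_ext : #|{: extT}| = (p * #|hT|)%N.
Proof. by rewrite card_prod card_Fp. Qed.

Lemma ker_ext_proj_cyclic : cyclic ('ker ext_proj)%g.
Proof.
have e : #|[set: extT] : 'ker ext_proj_morphism|%g = #|hT|.
  rewrite -card_quotient ?ker_norm // (card_isog (first_isog ext_proj_morphism)).
  by rewrite -cardsT; exact: (congr1 (fun A : {set hT} => #|A|) ext_proj_surj).
apply: prime_cyclic; have := Lagrange (subsetT ('ker ext_proj_morphism)%G).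
rewrite e cardsT card_scalar_ext => /eqP.
rewrite eqn_pmul2r; last by rewrite -cardsT (cardG_gt0 [set: hT]%G).
by move/eqP->.
Qed.

Lemma supersolvable_scalar_ext :
  supersolvable [set: hT]%G -> supersolvable [set: extT]%G.
Proof.
exact: (@supersolvable_preimage _ _ ext_proj_morphism ext_proj_surj ker_ext_proj_cyclic).
Qed.

Lemma derivation1 d : d \in derivations -> d 1%g = 0.
Proof.
move/derivationP/(_ 1%g 1%g)/eqP; rewrite mulg1 chi1 mulr1.
by rewrite -{1}[d 1%g]addr0 (inj_eq (addrI _)) eq_sym => /eqP.
Qed.

Lemma derivation_eq_gen (A : {set hT}) d1 d2 :
    d1 \in derivations -> d2 \in derivations -> (<<A>> = [set: hT])%g ->
  {in A, d1 =1 d2} -> d1 = d2.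
Proof.
move=> D1 D2 genA eqA; apply/ffunP => a.
pose B := [set a | d1 a == d2 a].
have gB : group_set B.
  apply/group_setP; split; first by rewrite inE !derivation1.
  move=> x y; rewrite !inE => /eqP ex /eqP ey.
  by rewrite (derivationP _ D1) (derivationP _ D2) ex ey.
have : (<<A>> \subset Group gB)%g.
  by rewrite gen_subG; apply/subsetP => x xA; rewrite inE eqA.
by rewrite genA => /subsetP/(_ a (in_setT _)); rewrite inE => /eqP.
Qed.

(** Lifts of a generating tuple [s] correspond to vectors of length [k] over ['F_p]. The values of a
    derivation along [s] give a lift inside its graph, a proper subgroup; distinct derivations give
    distinct vectors, so each excludes a lift. *)
Lemma leq_n_gen_tuples_scalar_ext k :
  (n_gen_tuples [set: extT]%G k <=
     n_gen_tuples [set: hT]%G k * (p ^ k - #|derivations|))%N.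
Proof.
apply: (leq_card_mul_fibres (f := map_tuple ext_proj)) => [t|s].
  rewrite !inE => /andP[_ /eqP gent]; apply/andP; split.
    by apply/allP => x _; rewrite inE.
  apply/eqP/(etrans _ ext_proj_surj).
  apply: etrans (congr1 (fun A : {set extT} => ext_proj @* A)%g gent).
  rewrite morphim_gen ?subsetT //.
  rewrite morphimEsub ?subsetT //; congr (<<_>>)%g; apply/setP => a; rewrite inE.
  apply/mapP/imsetP => [[x xt ->]|[x xt ->]]; exists x => //.
    by rewrite inE.
  by move: xt; rewrite inE.
rewrite inE => /andP[_ /eqP gens].
set S := (X in #|pred_of_set X|).
pose dv (d : {ffun hT -> 'F_p}) : k.-tuple 'F_p := map_tuple d s.
have injd : {in derivations &, injective dv}.
  move=> d1 d2 D1 D2 eqd; apply: (derivation_eq_gen D1 D2 gens) => a.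
  rewrite inE => /tnthP[i ->].
  by have := congr1 (fun t => tnth t i) eqd; rewrite !tnth_map.
have Sproj t : t \in S -> map_tuple ext_proj t = s.
  by rewrite inE => /andP[_ /eqP].
pose vec (t : k.-tuple extT) : k.-tuple 'F_p := map_tuple (fun x : extT => x.1) t.
have injv : {in S &, injective vec}.
  move=> t1 t2 /Sproj p1 /Sproj p2 eqv; apply/eq_from_tnth => i.
  have := congr1 (fun t => tnth t i) eqv.
  have := congr1 (fun t => tnth t i) (etrans p1 (esym p2)).
  rewrite !tnth_map /ext_proj; case: (tnth t1 i) => ? ?; case: (tnth t2 i) => ? ?.
  by move=> /= -> ->.
rewrite -(card_in_imset injv) -(card_in_imset injd).
have -> : (p ^ k = #|{: k.-tuple 'F_p}|)%N by rewrite card_tuple card_Fp.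
set V := [set dv x | x in _].
rewrite -(cardsC V) addKn; apply: subset_leq_card; apply/subsetP.
move=> _ /imsetP[t tS ->]; rewrite inE; apply/negP => /imsetP[d D eqd].
pose B := [set x : extT | x.1 == d x.2].
have gB : group_set B.
  apply/group_setP; split; first by rewrite inE /= derivation1.
  by move=> x y; rewrite !inE /= => /eqP-> /eqP->; rewrite (derivationP _ D).
have ts := Sproj t tS; move: tS; rewrite !inE => /andP[/andP[_ /eqP gent] _].
have : ([set: extT] \subset Group gB)%g.
  rewrite -gent gen_subG; apply/subsetP => x; rewrite inE => /tnthP[i ->].
  rewrite inE; have := congr1 (fun t => tnth t i) eqd; rewrite !tnth_map => ->.
  by rewrite -ts tnth_map.
(* This pair lies outside every graph, as a derivation vanishes at the identity. *)
move/subsetP/(_ ((1, 1%g) : extT) (in_setT _)); by rewrite inE /= derivation1.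
Qed.

End ScalarExtension.

(** * Counting derivations *)

Section DerivationCount.
Local Open Scope ring_scope.
Variables (p : nat) (hT : finGroupType) (chi : hT -> 'F_p).
Hypotheses (p_pr : prime p) (chiP : mulcharacter chi).

Lemma card_derivations_gt0 : (0 < #|derivations chi|)%N.
Proof.
apply/card_gt0P; exists [ffun=> 0]; apply/derivationP => a b.
by rewrite !ffunE mul0r addr0.
Qed.

(** The inner derivations [c * (chi x - 1)] are distinct for distinct [c]. *)
Lemma card_derivations_nontrivial a : chi a != 1 -> (p <= #|derivations chi|)%N.
Proof.
move=> chia; pose F (c : 'F_p) := [ffun x : hT => c * (chi x - 1)].
have injF : injective F.
  move=> c1 c2 /ffunP/(_ a); rewrite !ffunE => /mulIf; apply.
  by rewrite subr_eq0.
apply: (@leq_trans #|'F_p|); first by rewrite card_Fp.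
rewrite -cardsT -(card_imset _ injF); apply: subset_leq_card.
apply/subsetP => _ /imsetP[c _ ->]; apply/derivationP => x y.
rewrite !ffunE chiP.2 -mulrA -mulrDr; congr (_ * _).
by rewrite mulrBl mul1r addrA subrK.
Qed.

Lemma mulcharacter_ext : mulcharacter (fun x : scalar_ext chiP => chi (ext_proj x)).
Proof. by split=> [|x y]; [exact: chiP.1 | exact: chiP.2]. Qed.

(** The coordinate [x.1] is itself a derivation of the extension; its multiples are added to the
    derivations inflated from [hT]. This growth produces the successive exponents in the product. *)
Lemma card_derivations_ext :
  (p * #|derivations chi| <=
     #|derivations (fun x : scalar_ext chiP => chi (ext_proj x))|)%N.
Proof.
pose F (u : 'F_p * {ffun hT -> 'F_p}) : {ffun scalar_ext chiP -> 'F_p} :=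
  [ffun x : scalar_ext chiP => u.1 * x.1 + u.2 x.2].
pose S := setX [set: 'F_p] (derivations chi).
have injF : {in S &, injective F}.
  move=> [c1 d1] [c2 d2]; rewrite !inE /= => D1 D2 /ffunP eqF.
  have ec : c1 = c2.
    have := eqF (1, 1%g); rewrite !ffunE /= !mulr1 !(derivation1 chiP) ?addr0 //.
      by rewrite inE.
    by rewrite inE.
  congr (_, _) => //; apply/ffunP => a.
  by have := eqF (0, a); rewrite !ffunE /= !mulr0 !add0r.
rewrite -[X in (X * _)%N](card_Fp p_pr) -cardsT -cardsX -(card_in_imset injF).
apply: subset_leq_card; apply/subsetP => _ /imsetP[[c d] + ->].
rewrite in_setX => /andP[_ /derivationP D]; apply/derivationP => x y.
rewrite !ffunE /= D /ext_proj mulrDr mulrDl !mulrA.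
by rewrite -!addrA; congr (_ + _); rewrite addrCA.
Qed.

End DerivationCount.

(** * Additive characters and abelianisations *)

Section AdditiveCharacters.
Local Open Scope ring_scope.

(** For prime [r] this witnesses that [r] divides the order of the derived quotient, in a form that
    pulls back along the projections. *)
Definition has_additive_character (r : nat) (hT : finGroupType) : Prop :=
  exists2 f : hT -> 'F_r, (forall a b, f (a * b)%g = f a + f b) & exists a, f a != 0.

Lemma additive_character_derivation (p : nat) (hT : finGroupType) :
  (1 < #|derivations (fun _ : hT => (1%R : 'F_p))|)%N -> has_additive_character p hT.
Proof.
case/card_gt1P => d1 [d2 [/derivationP D1 /derivationP D2 neq]].
have [a neqa] : exists a, d1 a != d2 a.
  apply/existsP; rewrite -negb_forall; apply: contra neq => /forallP eqd.
  by apply/eqP/ffunP => a; apply/eqP.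
exists (fun a => d1 a - d2 a) => [x y|]; last by exists a; rewrite subr_eq0.
by rewrite D1 D2 !mulr1 opprD addrACA.
Qed.

(** Cauchy's theorem gives a unit [u] of order [r]; the character is [u ^+ f x]. *)
Lemma additive_mulcharacter (p r : nat) (hT : finGroupType) :
    prime p -> prime r -> (r %| p.-1)%N -> has_additive_character r hT ->
  exists2 chi : hT -> 'F_p, mulcharacter chi & exists a, chi a != 1.
Proof.
move=> p_pr r_pr r_dvd [f fD [a fa]].
have [u _ ou] : {u : {unit 'F_p} | u \in [set: {unit 'F_p}]%G & #[u]%g = r}.
  by apply: Cauchy => //; rewrite card_finField_unit card_Fp.
exists (fun x => FinRing.uval (u ^+ f x)%g); last first.
  exists a; rewrite -[1]/(FinRing.uval (1%g : {unit 'F_p})) (inj_eq val_inj).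
  rewrite -order_dvdn ou; apply: contra fa => r_fa; apply/eqP/val_inj => /=.
  apply/eqP; rewrite -leqn0 leqNgt; apply/negP => fa_gt0.
  have := dvdn_leq fa_gt0 r_fa; rewrite leqNgt.
  by rewrite -{2}(Fp_cast r_pr) ltn_ord.
split=> [|x y].
  have f1 : f 1%g = 0.
    by apply: (addrI (f 1%g)); rewrite -fD mulg1 addr0.
  by rewrite f1.
rewrite fD -[RHS]/(FinRing.uval (u ^+ f x * u ^+ f y)%g); congr FinRing.uval.
(* Addition in ['F_r] reduces modulo the left-hand modulus, which is [r] by primality. *)
have modr m : (m %% (Zp_trunc (pdiv r)).+2 = m %% r)%N by rewrite Fp_cast.
by rewrite -expgD -(expg_mod_order u (f x + f y)) ou /= modr.
Qed.

Lemma additive_character_pi (r : nat) (hT : finGroupType) : prime r ->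
  has_additive_character r hT ->
  (r \in \pi(#|[set: hT]%G / [set: hT]^`(1)|))%g.
Proof.
move=> r_pr [f fD [a fa]].
have fM : {in [set: hT]%G &, {morph f : x y / (x * y)%g}}.
  by move=> x y _ _; rewrite fD.
pose phi := Morphism fM.
apply/(mem_pi_der1P _ r_pr); exists ('ker phi)%G; first exact: ker_normal.
rewrite -card_quotient ?ker_norm // (card_isog (first_isog phi)).
have sT : (#|(phi @* setT)%g| %| r)%N.
  by have := cardSg (subsetT (phi @* setT)%G); rewrite cardsT card_Fp.
have /primeP[_ /(_ _ sT) /orP[|/eqP //]] := r_pr.
rewrite -trivg_card1 => /eqP im1.
have : f a \in (phi @* setT)%g by apply: mem_morphim; rewrite inE.
by rewrite (im1 : (phi @* setT = 1)%g) => /set1P fa0; case/eqP: fa.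
Qed.

End AdditiveCharacters.

(** * Building the supersoluble group prime by prime *)

Section BuildSupersolvable.

Lemma has_additive_character_ext p (hT : finGroupType) (chi : hT -> 'F_p)
    (chiP : mulcharacter chi) r :
  has_additive_character r hT -> has_additive_character r (scalar_ext chiP).
Proof.
case=> f fD [a fa]; exists (fun x => f (ext_proj x)) => [x y|]; first exact: fD.
by exists ((0%R, a) : scalar_ext chiP).
Qed.

(** Each step extends by one more ['F_p] through the pulled-back character. After [i] steps there
    are at least [p ^ (i + a)] derivations, whence the next factor [p ^ k - p ^ (i + a)]. *)
Lemma iterated_scalar_ext p d a (hT : finGroupType) (chi : hT -> 'F_p) :
    prime p -> mulcharacter chi -> p ^ a <= #|derivations chi| ->
    supersolvable [set: hT]%G ->
  exists (hT' : finGroupType) (chi' : hT' -> 'F_p),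
    [/\ supersolvable [set: hT']%G, #|hT'| = (p ^ d * #|hT|)%N,
        forall k, n_gen_tuples [set: hT']%G k <=
          n_gen_tuples [set: hT]%G k * \prod_(i < d) (p ^ k - p ^ (i + a)),
        forall r, has_additive_character r hT -> has_additive_character r hT'
      & [/\ mulcharacter chi', p ^ (d + a) <= #|derivations chi'|
          & (forall x, chi x = 1%R) -> forall x, chi' x = 1%R]].
Proof.
move=> p_pr chiP leD supT; elim: d => [|d [hT1 [chi1 [sup1 card1 gen1 add1 [chi1P leD1 triv1]]]]].
  exists hT, chi; split=> //; first by rewrite mul1n.
  by move=> k; rewrite big_ord0 muln1.
exists (scalar_ext chi1P), (fun x => chi1 (ext_proj x)); split.
- exact: supersolvable_scalar_ext.
- by rewrite card_scalar_ext // card1 expnS mulnA.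
- move=> k; apply: leq_trans (leq_n_gen_tuples_scalar_ext chi1P p_pr k) _.
  by rewrite big_ord_recr /= mulnA leq_mul // leq_sub2l.
- by move=> r /add1; apply: has_additive_character_ext.
split; first exact: mulcharacter_ext.
  apply: leq_trans (card_derivations_ext p_pr chi1P).
  by rewrite addSn expnS leq_mul2l leD1 orbT.
by move=> chi_triv x; rewrite triv1.
Qed.

(** For [a] true the start is a non-trivial character built from [r], with at least [p] derivations;
    otherwise the trivial one, with at least one. In the latter case the [p ^ d] or more derivations
    obtained yield a non-zero homomorphism to ['F_p]. *)
Lemma extend_by_prime p d (a : bool) (hT : finGroupType) :
    prime p -> supersolvable [set: hT]%G ->
    (a -> exists2 r, prime r /\ r %| p.-1 & has_additive_character r hT) ->
  exists hT' : finGroupType,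
    [/\ supersolvable [set: hT']%G, #|hT'| = (p ^ d * #|hT|)%N,
        forall k, n_gen_tuples [set: hT']%G k <=
          n_gen_tuples [set: hT]%G k * \prod_(i < d) (p ^ k - p ^ (i + a)),
        forall r, has_additive_character r hT -> has_additive_character r hT'
      & ~~ a -> 0 < d -> has_additive_character p hT'].
Proof.
move=> p_pr supT; case: a => [/(_ isT)[r [r_pr r_dvd] addr]|_].
  have [chi chiP [x chix]] := additive_mulcharacter p_pr r_pr r_dvd addr.
  have [hT' [chi' [? ? ? ? _]]] := iterated_scalar_ext (a := 1) d p_pr chiP
    (card_derivations_nontrivial p_pr chiP chix) supT.
  by exists hT'; split.
have chiP : mulcharacter (fun _ : hT => 1%R : 'F_p).
  by split=> // x y; rewrite GRing.mulr1.
have [hT' [chi' [? ? ? ? [chi'P leD triv]]]] := iterated_scalar_ext (a := 0) d p_pr chiP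
  (card_derivations_gt0 _) supT.
exists hT'; split=> // _ d_gt0; apply: additive_character_derivation.
have -> : derivations (fun _ : hT' => 1%R : 'F_p) = derivations chi'.
  apply/setP => f; apply/derivationP/derivationP => D x y; rewrite D.
    by rewrite triv.
  by rewrite triv.
by apply: leq_trans leD; rewrite addn0 -{1}(expn0 p) ltn_exp2l ?prime_gt1.
Qed.

(** The list is consumed from its end, so the prime [r] through which a twisted [p] is acted on must
    come after [p]: it is then present in the group being extended. *)
Lemma supersolvable_with_ranks (d : nat -> nat) (a : nat -> bool) (L : seq nat) :
    all prime L -> {in L, forall p, 0 < d p} ->
    (forall L1 p L2, L = L1 ++ p :: L2 -> a p ->
       exists2 r, r \in L2 & ~~ a r && (r %| p.-1)) ->
  exists hT : finGroupType,
    [/\ supersolvable [set: hT]%G, #|hT| = \prod_(p <- L) p ^ d p,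
        forall k, n_gen_tuples [set: hT]%G k <=
          \prod_(p <- L) \prod_(i < d p) (p ^ k - p ^ (i + a p))
      & {in L, forall r, ~~ a r -> has_additive_character r hT}].
Proof.
elim: L => [|p L IHL] /= prL dL aL.
  exists {perm 'I_0}; have card1 : #|[set: {perm 'I_0}]| = 1 by rewrite cardsT card_Sn.
  split=> //.
  - exists [::]; split=> //=; apply/val_inj/esym/trivgP.
    by rewrite subG1 trivg_card1 card1.
  - by rewrite -cardsT card1 big_nil.
  - move=> k; rewrite big_nil; apply: leq_trans (max_card _) _.
    by rewrite card_tuple -cardsT card1 exp1n.
case/andP: prL => p_pr prL.
have [||hT [supT cardT genT addT]] := IHL prL.
- by move=> q qL; apply: dL; rewrite inE qL orbT.
- by move=> L1 q L2 defL; apply: (aL (p :: L1)); rewrite defL.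
have [|hT' [sup' card' gen' add' addp]] := extend_by_prime (d p) (a := a p) p_pr supT.
  move=> ap; have [r rL /andP[nar r_dvd]] := aL [::] p L erefl ap.
  by exists r; [split=> //; apply: (allP prL) | apply: addT].
exists hT'; split=> //.
- by rewrite card' cardT big_cons.
- move=> k; apply: leq_trans (gen' k) _; rewrite big_cons mulnC leq_mul2l.
  by rewrite genT orbT.
- move=> r; rewrite inE => /orP[/eqP-> nap|rL nar]; first by apply: addp => //; apply: dL; rewrite mem_head.
  by apply: add'; apply: addT.
Qed.
End BuildSupersolvable.

(** * Ranks and prime parts of orders *)

Section RanksAndParts.
Local Open Scope group_scope.

Lemma min_gensE (gT : finGroupType) (G : {group gT}) : min_gens G = 'm(G).
Proof.
rewrite /min_gens; case: ex_minnP => n /existsP[t /eqP gent] minn.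
apply/eqP; rewrite eqn_leq; apply/andP; split.
  have [B genB <-] := grank_witness G; apply: minn.
  apply/existsP; exists (enum_tuple B); apply/eqP; rewrite -genB.
  by congr <<_>>; apply/setP => x; rewrite inE mem_enum.
rewrite -gent; apply: leq_trans (grank_min _) _.
by rewrite -[X in _ <= X](size_tuple t) cardsE card_size.
Qed.

(** Bounds the Sylow ranks of [H] from its order alone. *)
Lemma grank_leq_logn (gT : finGroupType) (Q : {group gT}) p :
  prime p -> p.-group Q -> 'm(Q) <= logn p #|Q|.
Proof.
move=> p_pr pQ; rewrite -(leq_exp2l _ _ (prime_gt1 p_pr)).
by rewrite expn_grank_pgroup // -(card_pgroup pQ) dvdn_leq ?cardG_gt0 ?dvdn_indexg.
Qed.

Lemma partn_prod_primes (d : nat -> nat) (L : seq nat) p : uniq L -> all prime L ->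
  prime p -> ((\prod_(q <- L) q ^ d q)`_p = if p \in L then p ^ d p else 1)%N.
Proof.
move=> uL prL p_pr.
have p'nat (s : seq nat) : all prime s -> p \notin s -> p^'.-nat (\prod_(q <- s) q ^ d q)%N.
  elim: s => [|q s IHs] /=; first by rewrite big_nil.
  case/andP => q_pr prs; rewrite inE negb_or big_cons => /andP[neq ps].
  by rewrite pnatM IHs // andbT pnatX pnatE // inE /= inE eq_sym neq.
have [pL|pL] := boolP (p \in L); last by rewrite part_p'nat ?p'nat.
rewrite (perm_big _ (perm_to_rem pL)) big_cons /=.
have prem : all prime (rem p L) by apply/allP => q /mem_rem /(allP prL).
have pr : p \notin rem p L by rewrite mem_rem_uniqF.
have := p'nat _ prem pr => p'r.
have r_gt0 : 0 < (\prod_(q <- rem p L) q ^ d q)%N by case/andP: p'r.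
rewrite partnM ?expn_gt0 ?(prime_gt0 p_pr) //.
by rewrite part_pnat_id ?pnatX ?pnat_id // part_p'nat // muln1.
Qed.

End RanksAndParts.

Theorem theorem6 (gT : finGroupType) (G : {group gT}) :
  solvable G ->
  exists (hT : finGroupType) (H : {group hT}),
    [/\ supersolvable H,
        \pi(#|G|) =i \pi(#|H|),
        (forall k : nat, (gen_prob H k <= gen_prob G k)%R),
        (forall p : nat, p \in \pi(#|G|) ->
           forall (P : {group gT}) (Q : {group hT}),
             P \in 'Syl_p(G)%g -> Q \in 'Syl_p(H)%g -> min_gens Q <= min_gens P)
      & {subset \pi(#|G / G^`(1)|%g) <= \pi(#|H / H^`(1)|%g)}].
Proof.
move=> solG.
pose s := primes #|(G / G^`(1))%g|; pose tw := twisted s G.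
(* Twisted primes come first in [L], so that the untwisted ones are built before them. *)
pose A := filter tw (primes #|G|); pose B := filter (predC tw) (primes #|G|).
pose L := A ++ B; pose d := sylow_rank G.
have permL : perm_eq L (primes #|G|) by rewrite /L perm_filterC.
have memL : L =i primes #|G| := perm_mem permL.
have uL : uniq L by rewrite (perm_uniq permL) primes_uniq.
have prL : all prime L.
  by apply/allP => p; rewrite memL mem_primes => /andP[].
have dL : {in L, forall p, 0 < d p}.
  by move=> p; rewrite memL; apply: sylow_rank_gt0.
have sL r : r \in s -> r \in B.
  move=> rs; rewrite mem_filter /= /tw /twisted rs /=.
  move: rs; rewrite !mem_primes => /and3P[-> _ r_dvd]; rewrite cardG_gt0.
  exact: dvdn_trans r_dvd (dvdn_quotient _ _).
have aL L1 p L2 : L = L1 ++ p :: L2 -> tw p ->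
    exists2 r, r \in L2 & ~~ tw r && (r %| p.-1).
  move=> defL twp; have /hasP[r rs r_dvd] : has (fun r => r %| p.-1) s.
    by case/andP: twp.
  have rB := sL r rs.
  exists r; last by move: rB; rewrite mem_filter /= r_dvd andbT => /andP[].
  (* As [p] is twisted, its position lies in the block [A]; hence all of [B] follows it. *)
  have ltA : size L1 < size A.
    rewrite ltnNge; apply/negP => leA.
    have : p \in B.
      have -> : p = nth 0 B (size L1 - size A).
        have := nth_cat 0 A B (size L1); rewrite ltnNge leA /= => <-.
        by rewrite -/L defL nth_cat ltnn subnn.
      rewrite mem_nth // ltn_subLR // -size_cat -/L defL size_cat /=.
      by rewrite addnS ltnS leq_addr.
    by rewrite mem_filter /= twp.
  have -> : L2 = drop (size L1).+1 A ++ B.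
    have -> : L2 = drop (size L1).+1 L.
      by rewrite defL -cat_rcons drop_size_cat ?size_rcons.
    rewrite /L drop_cat; move: ltA; rewrite leq_eqVlt => /orP[/eqP ->|->//].
    by rewrite ltnn subnn drop0 drop_size.
  by rewrite mem_cat rB orbT.
have [hT [supT cardT genT addT]] := supersolvable_with_ranks prL dL aL.
have partH p : prime p -> (#|[set: hT]%G|`_p = if p \in L then p ^ d p else 1)%N.
  by move=> p_pr; rewrite cardsT cardT partn_prod_primes.
exists hT, [set: hT]%G; split=> //.
(* A prime [q] divides the order of [H] when its [q]-part is not [1], that is when [q] is in [L],
   where [d q] is positive. *)
- move=> q; have [q_pr|nq] := boolP (prime q); last by rewrite !mem_primes (negPf nq).
  have := p_part_eq1 q #|[set: hT]%G|; rewrite (partH q q_pr) memL => /(congr1 negb).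
  rewrite negbK => <-; case: ifP => qG; last by rewrite eqxx.
  apply/esym; rewrite -(expn0 q) eqn_exp2l ?prime_gt1 //.
  by rewrite -lt0n; apply: dL; rewrite memL.
- move=> k; rewrite /gen_prob.
  (* Once denominators are cleared, the upper bound [genT] for [H] and the lower bound for [G] meet
     in the same product. *)
  rewrite ler_pdivrMr ?ltr0n ?expn_gt0 ?cardG_gt0 // mulrAC.
  rewrite ler_pdivlMr ?ltr0n ?expn_gt0 ?cardG_gt0 // -!natrM ler_nat.
  have sub_s : {subset \pi(#|G / G^`(1)|)%g <= s} by [].
  have subL : {subset \pi(#|G|) <= L} by move=> q; rewrite memL.
  have := n_gen_tuples_lower_bound k uL prL solG subL sub_s.
  rewrite cardsT cardT; apply: leq_trans; rewrite mulnC leq_mul2l.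
  by rewrite genT orbT.
- move=> p pG P Q; rewrite !inE => sylP sylQ.
  have p_pr : prime p by move: pG; rewrite mem_primes => /andP[].
  rewrite !min_gensE; apply: leq_trans (grank_leq_logn p_pr (pHall_pgroup sylQ)) _.
  rewrite (card_Hall sylQ) partH // memL (pG : p \in primes _) pfactorK //.
  by rewrite /d (sylow_rankE sylP).
- move=> r rs; have r_pr : prime r by move: rs; rewrite mem_primes => /andP[].
  have rB := sL r rs; apply: additive_character_pi => //; apply: addT.
    by rewrite mem_cat rB orbT.
  by move: rB; rewrite mem_filter => /andP[].
Qed.
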